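(* Let $(R,\mathfrak{m})$ be an unramified regular local ring of unequal characteristic, and let $I\supset J$ be ideals of $R$. Suppose that each of $I$ and $J$ is generated by a part of a regular system of parameters of $R$, and that $p:=\operatorname{char}(R/\mathfrak{m})\in J$. Then $\operatorname{Ass} H_I^i(J)$ is finite for any $i\geq 0$.
   Context: All rings are commutative with identity. $H_I^i(M)$ denotes the $i$-th local cohomology module of $M$ with respect to $I$, and $\operatorname{Ass} M$ is the set of associated primes of $M$. A regular local ring $(R,\mathfrak m)$ is of equal characteristic if $\operatorname{char}R=\operatorname{char}R/\mathfrak m$, and of unequal characteristic otherwise. If $(R,\mathfrak m)$ is of unequal characteristic with $\operatorname{char}R/\mathfrak m=p$, it is called unramified if $p\notin\mathfrak m^2$ (here $p$ is identified with its image in $R$). A regular system of parameters of an $r$-dimensional regular local ring $(R,\mathfrak m)$ is a set of $r$ elements generating $\mathfrak m$. The notation $I\supset J$ means containment, not necessarily strict. *)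

(* Defs.v *)
From HB Require Import structures.
From mathcomp Require Import all_boot all_algebra.
From mathcomp Require Import boolp classical_sets cardinality.

Set Implicit Arguments.
Unset Strict Implicit.
Unset Printing Implicit Defensive.

Import GRing.Theory.

Local Open Scope ring_scope.
Local Open Scope quotient_scope.
Local Open Scope classical_set_scope.

(* Submodules of V are terms of type [submodClosed V]; in particular an
   arbitrary (possibly improper) ideal of R is a term of type
   [submodClosed R^o].  MathComp's [idealr R] and [prime_idealr R] are the
   proper ideals and the prime ideals.  Membership is boolean, which is no
   restriction in the presence of [boolp]. *)

(* [submodClosed] does not record closure under opposite, although over a ring
   it is automatic; [submod_pred N] is N with that closure declared. *)
Definition submod_pred (R : nzRingType) (V : lmodType R) (N : submodClosed V) :
  {pred V} := fun x => x \in N.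

Fact submod_pred_closed (R : nzRingType) (V : lmodType R)
  (N : submodClosed V) : subsemimod_closed (submod_pred N).
Proof. exact: GRing.subsemimodClosedP. Qed.

HB.instance Definition _ (R : nzRingType) (V : lmodType R)
    (N : submodClosed V) :=
  GRing.isSubmodClosed.Build R V (submod_pred N) (submod_pred_closed N).

Section SubmoduleType.
Variables (R : nzRingType) (V : lmodType R) (N : submodClosed V).

Record submod_type : predArgType :=
  Submod { submod_val : V; submod_valP : submod_val \in submod_pred N }.

HB.instance Definition _ := [isSub for submod_val].
HB.instance Definition _ := [Choice of submod_type by <:].
HB.instance Definition _ := [SubChoice_isSubZmodule of submod_type by <:].
HB.instance Definition _ := [SubZmodule_isSubLmodule of submod_type by <:].

End SubmoduleType.

Section QuotientModule.
Variables (R : nzRingType) (V : lmodType R) (N : submodClosed V).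

Definition quot_module : Type := Quotient.quot (submod_pred N).

HB.instance Definition _ := GRing.Zmodule.on quot_module.

Definition quot_pi (v : V) : quot_module :=
  \pi_(Quotient.quot (submod_pred N)) v.

Definition quot_scale (a : R) (x : quot_module) : quot_module :=
  quot_pi (a *: (repr x : V)).

Fact quot_pi_eq (u v : V) : quot_pi u = quot_pi v <-> u - v \in N.
Proof.
rewrite -[u - v \in N]/(u - v \in submod_pred N).
by rewrite Quotient.idealrBE; split=> /eqP.
Qed.

Fact quot_piK (x : quot_module) : quot_pi (repr x) = x.
Proof. exact: reprK. Qed.

Fact quot_piD (u v : V) : quot_pi (u + v) = quot_pi u + quot_pi v.
Proof. exact: Quotient.pi_add. Qed.

Fact quot_piZ (a : R) (v : V) : quot_pi (a *: v) = quot_scale a (quot_pi v).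
Proof.
apply/quot_pi_eq; rewrite -scalerBr rpredZ //.
by apply/quot_pi_eq; rewrite quot_piK.
Qed.

Fact quot_scaleA (a b : R) (x : quot_module) :
  quot_scale a (quot_scale b x) = quot_scale (a * b) x.
Proof. by rewrite -(quot_piK x) -!quot_piZ scalerA. Qed.

Fact quot_scale1 : left_id 1 quot_scale.
Proof. by move=> x; rewrite -(quot_piK x) -quot_piZ scale1r. Qed.

Fact quot_scaleDr : right_distributive quot_scale +%R.
Proof.
move=> a x y; rewrite -(quot_piK x) -(quot_piK y) -quot_piD -!quot_piZ.
by rewrite scalerDr quot_piD.
Qed.

Fact quot_scaleDl (x : quot_module) :
  {morph quot_scale^~ x : a b / a + b}.
Proof.
by move=> a b; rewrite -(quot_piK x) -!quot_piZ scalerDl quot_piD.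
Qed.

HB.instance Definition _ := GRing.Zmodule_isLmodule.Build R quot_module
  quot_scaleA quot_scale1 quot_scaleDr quot_scaleDl.

End QuotientModule.

Section Ideals.
Variable R : comNzRingType.

Definition ideal_gen (S : set R) : set R :=
  [set x | exists (n : nat) (c s : 'I_n -> R),
     (forall k, S (s k)) /\ x = \sum_(k < n) c k * s k].

Definition ideal_pow (I : set R) (n : nat) : set R :=
  ideal_gen [set x | exists f : 'I_n -> R,
     (forall k, I (f k)) /\ x = \prod_(k < n) f k].

Definition generates (s : seq R) (I : {pred R}) : Prop :=
  [set` I] = ideal_gen [set` s].

Definition noetherian : Prop :=
  forall I : submodClosed R^o, exists s : seq R, generates s I.

Definition maximal_ideal (m : idealr R) : Prop :=
  forall I : idealr R, {subset m <= I} -> {subset I <= m}.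

Definition local_ring (m : idealr R) : Prop :=
  maximal_ideal m /\ forall m' : idealr R, maximal_ideal m' -> m' =i m.

Definition has_prime_chain (n : nat) : Prop :=
  exists P : 'I_n.+1 -> prime_idealr R, forall j k : 'I_n.+1, (j < k)%N ->
    {subset P j <= P k} /\ ~ {subset P k <= P j}.

Definition krull_dim (n : nat) : Prop :=
  has_prime_chain n /\ forall k, has_prime_chain k -> (k <= n)%N.

Definition regular_system_of_parameters (m : idealr R) (s : seq R) : Prop :=
  [/\ uniq s, krull_dim (size s) & generates s m].

Definition regular_local_ring (m : idealr R) : Prop :=
  [/\ noetherian, local_ring m &
      exists s, regular_system_of_parameters m s].

Definition generated_by_part_of_rsop (m : idealr R) (I : {pred R}) : Prop :=
  exists s t, [/\ regular_system_of_parameters m s,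
                  {subset t <= s} & generates t I].

End Ideals.

Definition has_char (S : nzRingType) (c : nat) : Prop :=
  forall n : nat, (n%:R = 0 :> S) <-> (c %| n)%N.

Definition equal_characteristic (R : comNzRingType) (m : idealr R) : Prop :=
  exists c, has_char R c /\ has_char {ideal_quot m} c.

Definition unramified_unequal_char (R : comNzRingType) (m : idealr R)
    (p : nat) : Prop :=
  [/\ ~ equal_characteristic m, has_char {ideal_quot m} p &
      ~ ideal_pow [set` m] 2 p%:R].

Definition associated_prime (R : comNzRingType) (M : lmodType R)
    (P : prime_idealr R) : Prop :=
  exists x : M, forall a : R, a \in P <-> a *: x = 0.

Definition Ass (R : comNzRingType) (M : lmodType R) : set (set R) :=
  [set [set` P] | P in [set Q : prime_idealr R | associated_prime M Q]].

Section Torsion.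
Variables (R : comNzRingType) (I : submodClosed R^o).

Definition is_torsion (M : lmodType R) (x : M) : Prop :=
  exists n, forall a, ideal_pow [set` I] n a -> a *: x = 0.

Definition torsion (M : lmodType R) : {pred M} := fun x => `[< is_torsion x >].

Fact torsion_subsemimod_closed M : subsemimod_closed (@torsion M).
Proof.
have powS n k a : ideal_pow [set` I] (n + k) a -> ideal_pow [set` I] n a.
  case=> [l [c [s [hs ->]]]].
  have /choice[f hf] : forall j : 'I_l, exists fg : R * R,
      (exists f : 'I_n -> R, (forall i, f i \in I) /\ fg.1 = \prod_i f i) /\
      s j = fg.2 * fg.1.
    move=> j; have [f [fI ->]] := hs j.
    exists (\prod_(i < n) f (lshift k i), \prod_(i < k) f (rshift n i)).
    split; last by rewrite big_split_ord mulrC.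
    by exists (fun i => f (lshift k i)); split=> // i; apply: fI.
  exists l, (fun j => c j * (f j).2), (fun j => (f j).1); split.
    by move=> j; have [[g gP] _] := hf j; exists g.
  by apply: eq_bigr => j _; have [_ ->] := hf j; rewrite mulrA.
split; [split=> [|x y] |].
- by apply/asboolP; exists 0%N => a _; rewrite scaler0.
- move=> /asboolP[n hn] /asboolP[k hk]; apply/asboolP; exists (n + k)%N => a ha.
  rewrite scalerDr hn; last exact: (powS n k).
  by rewrite hk ?addr0 //; apply: (powS k n); rewrite addnC.
- move=> b x /asboolP[n hn]; apply/asboolP; exists n => a ha.
  by rewrite scalerA mulrC -scalerA hn ?scaler0.
Qed.

HB.instance Definition _ M :=
  GRing.isSubmodClosed.Build R M (@torsion M) (@torsion_subsemimod_closed M).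

Definition Gamma (M : lmodType R) : lmodType R := submod_type (@torsion M).

Section Map.
Variables (M N : lmodType R) (f : {linear M -> N}).

Fact Gamma_map_subproof (x : Gamma M) : f (val x) \in @torsion N.
Proof.
have /asboolP[n hn] := submod_valP x; apply/asboolP; exists n => a ha.
by rewrite -linearZ hn ?linear0.
Qed.

Definition Gamma_map (x : Gamma M) : Gamma N := Submod (Gamma_map_subproof x).

Fact Gamma_map_is_linear : linear Gamma_map.
Proof. by move=> a x y; apply: val_inj; rewrite /= linearP. Qed.

HB.instance Definition _ :=
  GRing.isLinear.Build R (Gamma M) (Gamma N) _ Gamma_map Gamma_map_is_linear.

End Map.
End Torsion.

Arguments Gamma_map {R} I {M N} f x.

Section Cohomology.
Variables (R : comNzRingType) (C : nat -> lmodType R).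
Variable d : forall n, {linear C n -> C n.+1}.

Definition cocycle (n : nat) : {pred C n} := fun x => d n x == 0.

Fact cocycle_subsemimod_closed n : subsemimod_closed (@cocycle n).
Proof.
have E x : (x \in @cocycle n) = (d n x == 0) by [].
split; [split=> [|x y] | move=> a x]; rewrite !E.
- by rewrite linear0.
- by move=> /eqP hx /eqP hy; rewrite linearD hx hy addr0.
- by move=> /eqP hx; rewrite linearZ hx /= scaler0.
Qed.

HB.instance Definition _ n :=
  GRing.isSubmodClosed.Build R (C n) (@cocycle n) (cocycle_subsemimod_closed n).

Definition boundary (n : nat) : set (C n) :=
  match n with
  | 0 => [set 0]
  | k.+1 => range (d k)
  end.

(* Those cocycles that are boundaries; this is all boundaries as soon as
   d n.+1 \o d n = 0, which the construction does not need. *)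
Definition coboundary (n : nat) : {pred submod_type (@cocycle n)} :=
  fun z => `[< boundary (val z) >].

Fact coboundary_subsemimod_closed n : subsemimod_closed (@coboundary n).
Proof.
split; [split=> [|x y] |].
- by apply/asboolP; case: n => [|n] //=; exists 0 => //; rewrite linear0.
- move=> /asboolP hx /asboolP hy; apply/asboolP; move: hx hy.
  case: n x y => [|n] x y /=.
    by move=> hx hy; rewrite /= hx hy addr0.
  by case=> u _ hu [v _ hv]; exists (u + v) => //; rewrite linearD hu hv.
- move=> a x /asboolP hx; apply/asboolP; move: hx.
  case: n x => [|n] x /=; first by move=> ->; rewrite scaler0.
  by case=> u _ hu; exists (a *: u) => //; rewrite linearZ hu.
Qed.

HB.instance Definition _ n :=
  GRing.isSubmodClosed.Build R (submod_type (@cocycle n)) (@coboundary n)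
    (coboundary_subsemimod_closed n).

Definition cohomology (n : nat) : lmodType R := quot_module (@coboundary n).

End Cohomology.

Section InjectiveResolution.
Variable R : comNzRingType.

Definition injective_module (E : lmodType R) : Prop :=
  forall (A B : lmodType R) (f : {linear A -> B}) (g : {linear A -> E}),
    injective f -> exists h : {linear B -> E}, forall x, h (f x) = g x.

(* exactness of 0 -> M -> E 0 -> E 1 -> ... with every E n injective *)
Record injective_resolution (M : lmodType R) := InjectiveResolution {
  ires_obj : nat -> lmodType R;
  ires_diff : forall n, {linear ires_obj n -> ires_obj n.+1};
  ires_aug : {linear M -> ires_obj 0%N};
  ires_injective : forall n, injective_module (ires_obj n);
  ires_aug_inj : injective ires_aug;
  ires_exact0 : forall x, ires_diff 0%N x = 0 <-> exists y, ires_aug y = x;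
  ires_exactS : forall n x,
    ires_diff n.+1 x = 0 <-> exists y, ires_diff n y = x
}.

End InjectiveResolution.

(* H^i_I(M), the i-th right derived functor of Gamma_I, computed from an
   injective resolution E of M; it does not depend on E up to isomorphism. *)
Definition local_cohomology (R : comNzRingType) (I : submodClosed R^o)
    (M : lmodType R) (E : injective_resolution M) (i : nat) : lmodType R :=
  @cohomology R (fun n => Gamma I (ires_obj E n))
    (fun n => Gamma_map I (ires_diff E n)) i.

(* Main.v *)
From HB Require Import structures.
Require Import Defs.
From mathcomp Require Import all_boot all_algebra.
From mathcomp Require Import boolp classical_sets cardinality.

(* Every s outside the prime ideal I acts injectively on H = H_I^i(J), while
   every element of H is killed by a power of I; hence I is the only possible
   associated prime.  To see the injectivity, choose a regular system of
   parameters z_1, ..., z_d with J = (z_1, ..., z_c) and I = (z_1, ..., z_h) and,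
   given an injective resolution E of J, pass to the z_1-torsion of E, then to
   the z_2-torsion of the result, and so on.  Injectivity of the E^n makes
   z_(k+1) surjective on the (z_1, ..., z_k)-torsion T_k, so that H^n(T_(k+1))
   is an extension of the z_(k+1)-torsion of N = H^n(T_k) by N'_z / N' with
   N' = H^(n-1)(T_k) and z = z_(k+1); the latter is a union of copies of
   N' / z^j N' when z is regular on N'.  After the first step H^1 is an extension
   of R_z / R by R / J, where z_1, ..., z_c kill R / J and z_2, ..., z_h, s is
   regular on R_z / R.  Up to k = c these two pieces evolve in different degrees,
   and at the end s is regular on everything.  That z_1, ..., z_h, s is a
   regular sequence is proved from Krull's principal ideal theorem. *)

Set Implicit Arguments.
Unset Strict Implicit.
Unset Printing Implicit Defensive.

Import GRing.Theory.

Local Open Scope ring_scope.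
Local Open Scope classical_set_scope.

(** * Weakly regular sequences on subquotients *)

Section Submodules.
Variables (R : comNzRingType) (V : lmodType R).
Implicit Types (A B C Z : set V) (x a : R) (u v : V).

(** Submodules are plain sets and a subquotient is a pair of sets, so that no quotient module has to
    be formed. *)
Definition submod A := A 0 /\ forall a u v, A u -> A v -> A (a *: u + v).

Lemma submod0 A : submod A -> A 0.
Proof. by case. Qed.

Lemma submodD A u v : submod A -> A u -> A v -> A (u + v).
Proof. by case=> _ sA Au Av; rewrite -[u]scale1r; apply: sA. Qed.

Lemma submodZ A a u : submod A -> A u -> A (a *: u).
Proof. by case=> A0 sA Au; rewrite -[a *: u]addr0; apply: sA. Qed.

Lemma submodN A u : submod A -> A u -> A (- u).
Proof. by move=> sA Au; rewrite -scaleN1r; exact: submodZ. Qed.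

Lemma submodB A u v : submod A -> A u -> A v -> A (u - v).
Proof. by move=> sA Au Av; apply: (submodD sA Au); exact: submodN. Qed.

Lemma submodBl A u v : submod A -> A v -> A (u - v) -> A u.
Proof. by move=> sA Av Auv; rewrite -[u](subrK v); apply: submodD. Qed.

Lemma submodT : submod setT. Proof. by []. Qed.

Lemma submod_set0 : submod [set 0].
Proof. by split=> // a u v -> ->; rewrite /= scaler0 addr0. Qed.

(** The submodule [x Z + B]: dividing by it instead of [B] reduces [Z / B] modulo [x]. *)
Definition adjoin Z B x : set V :=
  [set v | exists z b, [/\ Z z, B b & v = x *: z + b]].

Lemma submod_adjoin Z B x : submod Z -> submod B -> submod (adjoin Z B x).
Proof.
move=> sZ sB; split.
  by exists 0, 0; split; [exact: submod0|exact: submod0|rewrite scaler0 addr0].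
move=> a _ _ [z [b [Zz Bb ->]]] [z' [b' [Zz' Bb' ->]]].
exists (a *: z + z'), (a *: b + b'); split; [by case: sZ => _; apply|by case: sB => _; apply|].
by rewrite !scalerDr !scalerA (mulrC x) addrACA.
Qed.

Lemma sub_adjoin Z B x : submod Z -> B `<=` adjoin Z B x.
Proof.
by move=> sZ b Bb; exists 0, b; rewrite scaler0 add0r; split=> //; apply: submod0.
Qed.

Lemma adjoin_scale Z B x z : submod B -> Z z -> adjoin Z B x (x *: z).
Proof. by move=> sB Zz; exists z, 0; rewrite addr0; split=> //; apply: submod0. Qed.

Lemma adjoin_sub Z B C x : submod C -> B `<=` C ->
  (forall z, Z z -> C (x *: z)) -> adjoin Z B x `<=` C.
Proof.
by move=> sC BC ZC _ [z [b [Zz Bb ->]]]; apply: submodD; [|apply: ZC|apply: BC].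
Qed.

(* The sequence [l] is weakly regular (no condition on the last quotient) on
   the subquotient [Z / B]. *)
Fixpoint wreg Z B (l : seq R) : Prop :=
  if l is x :: l' then
    (forall z, Z z -> B (x *: z) -> B z) /\ wreg Z (adjoin Z B x) l'
  else True.

Lemma wreg_triv Z B l : submod Z -> submod B -> Z `<=` B -> wreg Z B l.
Proof.
move=> sZ; elim: l B => //= x l IH B sB ZB; split=> [z /ZB //|].
by apply: IH; [apply: submod_adjoin|move=> z /ZB; apply: sub_adjoin].
Qed.

Lemma wreg_expr Z B x l n z : submod Z -> wreg Z B (x :: l) ->
  Z z -> B (x ^+ n *: z) -> B z.
Proof.
move=> sZ [reg _] Zz; elim: n => [|n IH]; first by rewrite scale1r.
rewrite exprS -scalerA => h; apply/IH/reg => //; exact: submodZ.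
Qed.

End Submodules.

Section Iso.
Variables (R : comNzRingType) (V V' : lmodType R).

(** The hypotheses say that [f] induces an isomorphism from [Z / B] to [Z' / B']; they persist when
    [x Z] and [x Z'] are adjoined, hence the induction on [l]. *)
Lemma wreg_iso (f : {linear V -> V'}) (Z B : set V) (Z' B' : set V') l :
  submod Z -> submod B -> submod Z' -> submod B' ->
  (forall z, Z z -> Z' (f z)) ->
  (forall z', Z' z' -> exists2 z, Z z & B' (z' - f z)) ->
  (forall z, Z z -> (B' (f z) <-> B z)) ->
  wreg Z B l <-> wreg Z' B' l.
Proof.
move=> sZ + sZ' + fZZ' fsurj; elim: l B B' fsurj => //= x l IH B B' fsurj sB sB' fB'.
have Bx : wreg Z (adjoin Z B x) l <-> wreg Z' (adjoin Z' B' x) l.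
  apply: IH; [|exact: submod_adjoin|exact: submod_adjoin|].
    move=> z' /fsurj[z Zz h]; exists z => //; exact: sub_adjoin.
  move=> z Zz; split.
    move=> [z' [b' [Z'z' Bb' eq]]]; have [z1 Zz1 h] := fsurj _ Z'z'.
    have : B (z - x *: z1).
      apply/fB'; first by apply: submodB => //; apply: submodZ.
      rewrite linearB linearZ eq (_ : _ - _ = x *: (z' - f z1) + b').
        by case: sB' => _; apply.
      by rewrite scalerBr addrAC.
    by move=> h1; exists z1, (z - x *: z1); rewrite addrCA subrr addr0.
  move=> [z1 [b [Zz1 Bb eq]]]; rewrite eq linearD linearZ; exists (f z1), (f b).
  split=> //; first exact: fZZ'.
  have -> : b = z - x *: z1 by rewrite eq addrAC subrr add0r.
  have zz : Z (z - x *: z1) by apply: submodB => //; apply: submodZ.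
  by apply/(fB' _ zz); rewrite eq addrAC subrr add0r.
split=> -[reg h]; split; try by apply/Bx.
  move=> z' Z'z' B'xz'; have [z Zz h1] := fsurj _ Z'z'.
  apply: (submodBl sB' _ h1).
  apply/fB' => //; apply: reg => //; apply/fB'; first exact: submodZ.
  rewrite linearZ; apply: (submodBl sB' B'xz').
  by rewrite -scalerBr -opprB scalerN; apply: submodN => //; exact: submodZ.
move=> z Zz Bxz; apply/fB' => //; apply: reg; first exact: fZZ'.
by rewrite -linearZ; apply/fB' => //; apply: submodZ.
Qed.

End Iso.

Section Closure.
Variables (R : comNzRingType) (V : lmodType R).
Implicit Types (A B C Z : set V).

(** Since [x] is regular on [A / B], reducing [0 -> B/C -> A/C -> A/B -> 0] modulo [x] leaves it
    exact. *)
Lemma wreg_ext A B C l : submod A -> submod B -> submod C ->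
  C `<=` B -> B `<=` A -> wreg A B l -> wreg B C l -> wreg A C l.
Proof.
move=> sA; elim: l B C => //= x l IH B C sB sC CB BA [regAB wAB] [regBC wBC].
split=> [z Az Cxz|].
  have Bz : B z by apply: regAB => //; apply: CB.
  exact: regBC.
have sBA : submod (adjoin A B x) by apply: submod_adjoin.
have sCA : submod (adjoin A C x) by apply: submod_adjoin.
have sCB : submod (adjoin B C x) by apply: submod_adjoin.
apply: (IH (adjoin A B x)) => //.
- move=> _ [z [b [Az Cb ->]]]; exists z, b; split=> //; exact: CB.
- apply: adjoin_sub => // z Az; exact: submodZ.
(* Exactness on the left: [B / (xB + C)] maps isomorphically onto [(xA + B) / (xA + C)]. *)
apply/(@wreg_iso _ _ _ idfun B (adjoin B C x) _ _ l) => //.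
- move=> z Bz; exact: sub_adjoin.
- move=> _ [z [b [Az Bb ->]]]; exists b => //; rewrite addrK; exact: adjoin_scale.
- move=> b Bb; rewrite /=; split=> -[z [c [Az Cc e]]].
    exists z, c; split=> //; apply: regAB => //.
    have -> : x *: z = b - c by rewrite e addrK.
    by apply: submodB => //; apply: CB.
  by exists z, c; split=> //; apply: BA.
Qed.

(** [adjoin] commutes with increasing unions, and each regularity condition involves finitely many
    elements, which lie in a common stage. *)
Lemma wreg_bigcup (M B : nat -> set V) l :
  (forall n, submod (M n)) -> (forall n, submod (B n)) ->
  (forall n, M n `<=` M n.+1) -> (forall n, B n `<=` B n.+1) ->
  (forall n, wreg (M n) (B n) l) ->
  wreg (\bigcup_n M n) (\bigcup_n B n) l.
Proof.
move=> sM + Mi.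
have mono (A : nat -> set V) : (forall n, A n `<=` A n.+1) ->
    forall n k, (n <= k)%N -> A n `<=` A k.
  move=> Ai n k /subnK <-; elim: (k - n)%N => // j IH v /IH; exact: Ai.
elim: l B => //= x l IH B sB Bi w; split.
  move=> z [n _ Mz] [k _ Bz]; exists (maxn n k) => //.
  apply: (w _).1; first by apply: mono Mz => //; apply: leq_maxl.
  by apply: mono Bz => //; apply: leq_maxr.
rewrite (_ : adjoin _ _ _ = \bigcup_n (adjoin (M n) (B n) x)).
  apply: IH => n; [exact: submod_adjoin| |exact: (w n).2].
  by move=> _ [z [b [Mz Bb ->]]]; exists z, b; split=> //; [exact: Mi|exact: Bi].
apply/seteqP; split=> [_ [z [b [[n _ Mz] [k _ Bb] ->]]]|].
  exists (maxn n k) => //; exists z, b; split=> //.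
    by apply: mono Mz => //; apply: leq_maxl.
  by apply: mono Bb => //; apply: leq_maxr.
by move=> _ [n _ [z [b [Mz Bb ->]]]]; exists z, b; split=> //; exists n.
Qed.

(** [Z / (x^{n+1} Z + B)] is an extension of [Z / (x^n Z + B)] by a copy of [Z / (x Z + B)],
    embedded through multiplication by [x^n]. *)
Lemma wreg_adjoin_expr Z B x l n : submod Z -> submod B -> B `<=` Z ->
  wreg Z B (x :: l) -> wreg Z (adjoin Z B (x ^+ n)) l.
Proof.
move=> sZ sB BZ w; elim: n => [|n IH].
  apply: wreg_triv => //; first exact: submod_adjoin.
  by move=> z Zz; rewrite -[z]scale1r; apply: adjoin_scale.
have sBn k : submod (adjoin Z B (x ^+ k)) by apply: submod_adjoin.
apply: (wreg_ext (B := adjoin Z B (x ^+ n))) => //.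
- move=> _ [z [b [Zz Bb ->]]]; exists (x *: z), b.
  by split=> //; [exact: submodZ|rewrite scalerA -exprSr].
- by apply: adjoin_sub => // z Zz; apply: submodZ.
apply/(@wreg_iso _ _ _ (x ^+ n \*: idfun) Z (adjoin Z B x) _ _ l) => //.
- exact: submod_adjoin.
- by move=> z Zz; apply: adjoin_scale.
- move=> _ [z [b [Zz Bb ->]]]; exists z => //; rewrite addrC addKr.
  exact: sub_adjoin.
- move=> z Zz; rewrite /=; split=> -[z1 [b [Zz1 Bb e]]]; last first.
    exists z1, (x ^+ n *: b); split=> //; first exact: submodZ.
    by rewrite e scalerDr scalerA exprSr.
  exists z1, (z - x *: z1); split=> //; last by rewrite addrCA subrr addr0.
  apply: (wreg_expr (n := n) sZ w).
    by apply: submodB => //; apply: submodZ.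
  by rewrite scalerBr scalerA -exprSr e addrC addKr.
- by case: w.
Qed.

End Closure.

(** * Ideals of a noetherian ring *)

Section Span.
Variables (R : comNzRingType) (V : lmodType R).
Implicit Types (Z B C : set V) (l : seq R).

Definition adjoins Z B l := foldr (fun x C => adjoin Z C x) B l.

Lemma submod_adjoins Z B l : submod Z -> submod B -> submod (adjoins Z B l).
Proof. by move=> sZ sB; elim: l => //= x l; apply: submod_adjoin. Qed.

Lemma sub_adjoins Z B l : submod Z -> B `<=` adjoins Z B l.
Proof. by move=> sZ; elim: l => //= x l IH b /IH; apply: sub_adjoin. Qed.

Lemma adjoins_scale Z B l x z : submod Z -> submod B ->
  x \in l -> Z z -> adjoins Z B l (x *: z).
Proof.
move=> sZ sB; elim: l => //= y l IH; rewrite inE => /orP[/eqP -> Zz|xl Zz].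
  by apply: adjoin_scale => //; apply: submod_adjoins.
by apply: sub_adjoin => //; apply: IH.
Qed.

Lemma adjoins_sub Z B C l : submod C -> B `<=` C ->
  (forall x z, x \in l -> Z z -> C (x *: z)) -> adjoins Z B l `<=` C.
Proof.
move=> sC BC; elim: l => //= x l IH h; apply: adjoin_sub => //.
  by apply: IH => y z yl; apply: h; rewrite inE yl orbT.
by move=> z; apply: h; rewrite inE eqxx.
Qed.

End Span.

Section Ideals.
Variable R : comNzRingType.
Implicit Types (A B C D P Q : set R) (a b r s x y : R) (l : seq R).

Definition is_ideal A := @submod R R^o A.

Lemma ideal0 A : is_ideal A -> A 0.
Proof. exact: (@submod0 R R^o). Qed.

Lemma idealM A a u : is_ideal A -> A u -> A (a * u).
Proof. exact: (@submodZ R R^o). Qed.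

Lemma idealMl A a u : is_ideal A -> A u -> A (u * a).
Proof. by rewrite mulrC; apply: idealM. Qed.

Lemma idealD A u v : is_ideal A -> A u -> A v -> A (u + v).
Proof. exact: (@submodD R R^o). Qed.

Lemma idealB A u v : is_ideal A -> A u -> A v -> A (u - v).
Proof. exact: (@submodB R R^o). Qed.

Lemma idealBl A u v : is_ideal A -> A v -> A (u - v) -> A u.
Proof. exact: (@submodBl R R^o). Qed.

Lemma ideal_intro A : A 0 -> (forall u v, A u -> A v -> A (u + v)) ->
  (forall a u, A u -> A (a * u)) -> is_ideal A.
Proof. by move=> A0 AD AM; split=> // a u v Au Av; apply: AD => //; apply: AM. Qed.

Definition is_prime P :=
  [/\ is_ideal P, ~ P 1 & forall a b, P (a * b) -> P a \/ P b].

Lemma primeM P a b : is_prime P -> ~ P a -> ~ P b -> ~ P (a * b).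
Proof. by case=> _ _ h na nb /h[]. Qed.

Lemma primeX P a n : is_prime P -> ~ P a -> ~ P (a ^+ n).
Proof.
move=> pP na; elim: n => [|n IH]; first by case: pP.
by rewrite exprS; apply: primeM.
Qed.

Definition idl l : set R := @adjoins R R^o setT [set 0] l.

Lemma idl_ideal l : is_ideal (idl l).
Proof. exact: (submod_adjoins _ (@submodT R R^o) (@submod_set0 R R^o)). Qed.

Lemma mem_idl l x : x \in l -> idl l x.
Proof.
move=> xl; have := adjoins_scale (@submodT R R^o) (@submod_set0 R R^o) xl
  (I : setT (1 : R^o)).
by rewrite /= /GRing.scale /= mulr1.
Qed.

Lemma idl_sub l A : is_ideal A -> (forall x, x \in l -> A x) -> idl l `<=` A.
Proof.
move=> iA h; apply: (@adjoins_sub R R^o) => // [_ ->|x z /h Ax _]; first exact: ideal0.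
exact: idealMl.
Qed.

Lemma idl_subl l1 l2 : (forall x, x \in l1 -> idl l2 x) -> idl l1 `<=` idl l2.
Proof. by move=> h; apply: idl_sub h; apply: idl_ideal. Qed.

Lemma idl_adjoin l x : @adjoin R R^o setT (idl l) x = idl (rcons l x).
Proof.
apply/seteqP; split.
  apply: adjoin_sub; first exact: idl_ideal.
    by apply: idl_subl => y yl; apply: mem_idl; rewrite mem_rcons inE yl orbT.
  move=> z _; apply: (idealMl (A := idl _)); first exact: idl_ideal.
  by apply: mem_idl; rewrite mem_rcons inE eqxx.
apply: idl_sub.
  by apply: submod_adjoin => //; apply: idl_ideal.
move=> y; rewrite mem_rcons inE => /orP[/eqP ->|yl].
  exists 1, 0; split=> //; first exact: (ideal0 (idl_ideal l)).
  by rewrite /GRing.scale /= mulr1 addr0.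
by apply: sub_adjoin => //; apply: mem_idl.
Qed.

Lemma ideal_genE l : ideal_gen [set` l] = idl l.
Proof.
apply/seteqP; split.
  move=> _ [n [c [s [hs ->]]]]; apply: big_ind.
  - exact: (ideal0 (idl_ideal l)).
  - by move=> u v; apply: idealD; apply: idl_ideal.
  - by move=> k _; apply: idealM; [apply: idl_ideal|apply/mem_idl/hs].
have gD : is_ideal (ideal_gen [set` l]).
  split; first by exists 0%N, (fun _ => 0), (fun _ => 0); rewrite big_ord0; split=> // -[].
  move=> a _ _ [n [c [s [hs ->]]]] [k [c' [s' [hs' ->]]]].
  exists (n + k)%N, (fun i => match split i with inl j => a * c j | inr j => c' j end),
    (fun i => match split i with inl j => s j | inr j => s' j end).
  split; first by move=> i; case: split.
  rewrite big_split_ord /=; congr (_ + _).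
    rewrite [LHS]mulr_sumr; apply: eq_bigr => i _.
    by rewrite -[lshift k i]/(unsplit (inl i)) unsplitK mulrA.
  apply: eq_bigr => i _.
  by rewrite -[rshift n i]/(unsplit (inr i)) unsplitK.
apply: idl_sub => // x xl.
exists 1%N, (fun _ => 1), (fun _ => x); split=> //.
by rewrite big_ord1 mul1r.
Qed.

Lemma generatesE l (I : {pred R}) : generates l I <-> [set` I] = idl l.
Proof. by rewrite /generates ideal_genE. Qed.

(** Bundled so that the boolean predicate below can carry a [submodClosed] instance, the form in
    which [noetherian] quantifies over ideals. *)
Record ideal_rec := IdealRec { ideal_set :> set R; ideal_recP : is_ideal ideal_set }.

Definition ideal_pred (A : ideal_rec) : {pred R^o} := fun x => `[< ideal_set A x >].

Fact ideal_pred_closed (A : ideal_rec) : subsemimod_closed (ideal_pred A).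
Proof.
have iA := ideal_recP A.
split; [split=> [|x y /asboolP hx /asboolP hy]|move=> a x /asboolP hx]; apply/asboolP.
- exact: (ideal0 iA).
- exact: idealD.
- exact: idealM.
Qed.

HB.instance Definition _ (A : ideal_rec) :=
  GRing.isSubmodClosed.Build R R^o (ideal_pred A) (ideal_pred_closed A).

Lemma noetherian_fg A : noetherian R -> is_ideal A -> exists l, A = idl l.
Proof.
move=> nR iA; have [l] := nR (ideal_pred (IdealRec iA)).
move=> /generatesE e; exists l; rewrite -e; apply/seteqP.
by split=> x; rewrite /= -[x \in _]/(`[< A x >]) asboolE.
Qed.

Lemma noetherian_max (F : set (set R)) A0 : noetherian R ->
  (forall A, F A -> is_ideal A) -> F A0 ->
  exists A, [/\ F A, A0 `<=` A & forall B, F B -> A `<=` B -> B `<=` A].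
Proof.
move=> nR Fi FA0; apply: contrapT => nomax.
have /choice[nxt nxtP] A : exists B, F A -> A0 `<=` A ->
    [/\ F B, A `<=` B & ~ B `<=` A].
  have [FA|nFA] := pselect (F A); last by exists A.
  have [AA|nAA] := pselect (A0 `<=` A); last by exists A.
  apply: contrapT => /forallNP h; apply: nomax; exists A; split=> // B FB AB.
  by apply: contrapT => BA; apply: (h B).
pose c n := iter n nxt A0.
have cF n : F (c n) /\ A0 `<=` c n.
  elim: n => [|n [Fc Ac]]; first by split.
  have [? h _] := nxtP _ Fc Ac.
  by split=> //; apply: subset_trans h.
have cS n : c n `<=` c n.+1 by have [Fc Ac] := cF n; have [] := nxtP _ Fc Ac.
have mono n k : (n <= k)%N -> c n `<=` c k.
  by move=> /subnK <-; elim: (k - n)%N => // j IH v /IH; apply: cS.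
have iU : is_ideal (\bigcup_n c n).
  split; first by exists 0%N => //; exact: (ideal0 (Fi _ FA0)).
  move=> a u v [n _ cu] [k _ cv]; exists (maxn n k) => //.
  apply: (Fi _ (cF _).1).2; first by apply: mono cu; apply: leq_maxl.
  by apply: mono cv; apply: leq_maxr.
have [l e] := noetherian_fg nR iU.
have [N hN] : exists N, forall x, x \in l -> c N x.
  have : forall x, x \in l -> (\bigcup_n c n) x by move=> x /mem_idl; rewrite e.
  elim: l {e} => [|x l IH] h; first by exists 0%N.
  have [|N hN] := IH; first by move=> y yl; apply: h; rewrite inE yl orbT.
  have [k _ ck] := h x (mem_head _ _); exists (maxn N k) => y.
  rewrite inE => /orP[/eqP ->|/hN]; first by apply: mono ck; apply: leq_maxr.
  by apply: mono; apply: leq_maxl.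
have [Fc Ac] := cF N; have [_ _] := nxtP _ Fc Ac; apply=> x cx.
apply: (idl_sub (Fi _ Fc) hN); rewrite -e; exists N.+1 => //.
Qed.

Definition colon A b : set R := [set r | A (r * b)].

Lemma colon_ideal A b : is_ideal A -> is_ideal (colon A b).
Proof.
move=> iA; apply: ideal_intro => [|u v hu hv|a u hu]; rewrite /colon /=.
- by rewrite mul0r; exact: (ideal0 iA).
- by rewrite mulrDl; apply: idealD.
- by rewrite -mulrA; apply: idealM.
Qed.

(** Take a maximal annihilator [A : b] of a nonzero element of [R / A]. If it contains [r s] but not
    [s], then [A : sb] contains both it and [r], so [r] lies in it. *)
Lemma colon_prime A : noetherian R -> is_ideal A -> ~ A 1 ->
  exists2 b, ~ A b & is_prime (colon A b).
Proof.
move=> nR iA nA1.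
pose F := [set B | exists2 b, ~ A b & B = colon A b].
have [||B [[b nb eB] _ maxB]] := @noetherian_max F (colon A 1) nR.
- by move=> _ [b _ ->]; apply: colon_ideal.
- by exists 1.
exists b => //; split; first exact: colon_ideal.
  by rewrite /colon /= mul1r.
move=> r s; rewrite /colon /= -mulrA => h.
have [|nsb] := pselect (A (s * b)); [by right|left].
have : colon A (s * b) `<=` colon A b.
  rewrite -eB; apply: maxB; first by exists (s * b).
  by rewrite eB => t; rewrite /colon /= mulrCA; apply: idealM.
exact.
Qed.

(** * Saturation, finite length after localization, and Nakayama's lemma *)

Definition mult_closed (S : set R) := S 1 /\ forall a b, S a -> S b -> S (a * b).

Lemma prime_mult_closed P : is_prime P -> mult_closed (~` P).
Proof. by move=> pP; split; [case: pP|move=> a b; apply: primeM]. Qed.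

(* The preimage in [R] of the extension of [A] to the localization at [S]. *)
Definition satur (S A : set R) : set R := [set a | exists2 s, S s & A (s * a)].

Definition saturated (S A : set R) :=
  is_ideal A /\ forall s a, S s -> A (s * a) -> A a.

Lemma saturated_satur S A : mult_closed S -> is_ideal A -> saturated S (satur S A).
Proof.
move=> [S1 SM] iA; split; [apply: ideal_intro|].
- by exists 1 => //; rewrite mulr0; exact: (ideal0 iA).
- move=> u v [s ns hs] [t nt ht]; exists (s * t); first exact: SM.
  rewrite mulrDr; apply: idealD => //; last by rewrite -mulrA; apply: idealM.
  by rewrite (mulrC s) -mulrA; apply: idealM.
- by move=> a u [s ns hs]; exists s => //; rewrite mulrCA; apply: idealM.
- by move=> s a ns [t nt h]; exists (t * s); [exact: SM|rewrite -mulrA].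
Qed.

Lemma sub_satur S A : mult_closed S -> A `<=` satur S A.
Proof. by case=> S1 _ a; exists 1 => //; rewrite mul1r. Qed.

Lemma saturS S A B : A `<=` B -> satur S A `<=` satur S B.
Proof. by move=> AB a [s ns /AB]; exists s. Qed.

(** Finite length of [R_P / A R_P] without localized modules: each step adjoins an element killed by
    [P] modulo [A] and saturates, so it costs length at most one. *)
Inductive finite_colength P : set R -> Prop :=
| FiniteColengthTop A : A 1 -> finite_colength P A
| FiniteColengthStep A b : (forall r, P r -> A (r * b)) ->
    finite_colength P (satur (~` P) (@adjoin R R^o setT A b)) -> finite_colength P A.

Lemma finite_colength_dcc P A (D : nat -> set R) : is_prime P ->
  finite_colength P A -> (forall n, saturated (~` P) (D n)) ->
  (forall n, A `<=` D n) -> (forall n, D n.+1 `<=` D n) ->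
  exists N, forall n, (N <= n)%N -> D n `<=` D n.+1.
Proof.
move=> pP fc; have mP := prime_mult_closed pP; elim: fc D => {A} [A A1|A b Pb _ IH] D sD AD Di.
  exists 0%N => n _ a _; rewrite -[a]mulr1; apply: idealM; first by case: (sD n.+1).
  exact: AD.
have sT := @submodT R R^o; have iD n : is_ideal (D n) by case: (sD n).
pose D' n := satur (~` P) (@adjoin R R^o setT (D n) b).
have [|||N hN] := IH D'.
- by move=> n; apply: saturated_satur => //; apply: submod_adjoin => //; exact: iD.
- by move=> n; apply: saturS => _ [z [c [_ /AD Dc ->]]]; exists z, c.
- by move=> n; apply: saturS => _ [z [c [_ /Di Dc ->]]]; exists z, c.
have [Db|/existsNP[M nDb]] := pselect (forall n, D n b).
  exists N => n Nn a Da.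
  have [|s ns [z [c [_ Dc e]]]] := hN n Nn a.
    by apply: sub_satur => //; apply: sub_adjoin.
  case: (sD n.+1) => _ /(_ s a ns); apply; rewrite e.
  by apply: idealD => //; apply: idealMl.
(* Once [b] has dropped out of the chain, a multiple of [b] in [D n] has its coefficient in [P],
   hence lies in [A]. So stationarity with [b] adjoined descends to [D] itself. *)
exists (maxn N M) => n; rewrite geq_max => /andP[Nn Mn] a Da.
have nDnb : ~ D n b.
  move=> h; apply: nDb; move: h; rewrite -(subnK Mn).
  by elim: (n - M)%N => // j IHj /Di.
have [|s ns [z [c [_ Dc e]]]] := hN n Nn a.
  by apply: sub_satur => //; apply: sub_adjoin.
case: (sD n.+1) => _ /(_ s a ns); apply; rewrite e.
apply: idealD => //; rewrite /GRing.scale /= mulrC; apply: AD; apply: Pb.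
apply: contrapT => nz; apply: nDnb; case: (sD n) => _ /(_ z b nz); apply.
rewrite mulrC (_ : b * z = s * a - c); last by rewrite e addrK.
by apply: idealB => //; [apply: idealM|apply: Di].
Qed.

(** Noetherian induction. For a maximal counterexample [A], a prime [A : b] contains [A0] and lies
    in [P] by saturation, so it contains [P] by minimality; adjoining [b] is then a step to a larger
    ideal. *)
Lemma finite_colength_minimal P A0 : noetherian R -> is_prime P ->
  (forall Q, is_prime Q -> A0 `<=` Q -> Q `<=` P -> P `<=` Q) ->
  saturated (~` P) A0 -> finite_colength P A0.
Proof.
move=> nR pP minP sA0; have mP := prime_mult_closed pP; apply: contrapT => nfc.
pose F := [set A | [/\ saturated (~` P) A, A0 `<=` A & ~ finite_colength P A]].
have [||A [[[iA sA] A0A nA] _ maxA]] := @noetherian_max F A0 nR.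
- by move=> A [[]].
- by split.
apply: nA; have [A1|nA1] := pselect (A 1); first exact: FiniteColengthTop.
have [b nb pb] := colon_prime nR iA nA1.
have Pb : P `<=` colon A b.
  apply: minP => // [a /A0A|r rb]; first by move=> Aa; apply: idealMl.
  by apply: contrapT => /sA h; apply/nb/h.
apply: (FiniteColengthStep (b := b)) => //; apply: contrapT => nfc'.
have iAb : is_ideal (@adjoin R R^o setT A b) by apply: submod_adjoin.
have AAb : A `<=` @adjoin R R^o setT A b by exact: (@sub_adjoin R R^o).
have := maxA (satur (~` P) (@adjoin R R^o setT A b)); apply: contraPP => _.
move=> /(_ _ _ b) h; apply: nb; apply: h.
- split=> //; first exact: saturated_satur.
  by apply: (subset_trans A0A); apply: (subset_trans AAb); apply: sub_satur.
- by apply: (subset_trans AAb); apply: sub_satur.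
- apply: sub_satur => //; exists 1, 0; split=> //; first exact: (ideal0 iA).
  by rewrite /GRing.scale /= mulr1 addr0.
Qed.

(** Generators are eliminated one by one: [s g = p g + u] with [p] in [P] gives [(s - p) g = u] with
    [s - p] outside [P], which is substituted into the relations for the others. *)
Lemma nakayama P N l : is_prime P -> saturated (~` P) N ->
  (forall v, v \in l -> exists2 s, ~ P s & @adjoins R R^o P N l (s * v)) ->
  forall v, v \in l -> N v.
Proof.
move=> pP [iN sN]; have iP : is_ideal P by case: pP.
elim: l => // g l IH h.
have [s ns [p [u [Pp hu e]]]] := h g (mem_head _ _).
have iE : is_ideal (@adjoins R R^o P N l) by apply: submod_adjoins.
have ns' : ~ P (s - p) by move=> h'; apply: ns; apply: idealBl h'.
have e' : (s - p) * g = u.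
  by rewrite mulrBl e /GRing.scale /= [p * g]mulrC addrAC subrr add0r.
have Nl v : v \in l -> N v.
  apply: IH => {}v vl; have [|t nt [q [w [Pq hw ew]]]] := h v.
    by rewrite inE vl orbT.
  exists ((s - p) * t); first exact: primeM.
  rewrite -mulrA ew mulrDr; apply: idealD => //; last exact: idealM.
  by rewrite mulrA e'; apply: idealMl.
move=> v; rewrite inE => /orP[/eqP ->|/Nl //].
apply: (sN _ _ ns'); rewrite e'; apply: adjoins_sub hu => //.
by move=> x z /Nl Nx _; apply: idealMl.
Qed.

Lemma adjoins_mul P N l x c : is_ideal P -> is_ideal N -> P x -> idl l c ->
  @adjoins R R^o P N l (x * c).
Proof.
move=> iP iN Px; have iE : is_ideal (@adjoins R R^o P N l) by apply: submod_adjoins.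
move: c; apply: (@idl_sub _ [set c | @adjoins R R^o P N l (x * c)]).
  apply: ideal_intro => [|u v hu hv|a u hu] /=.
  - by rewrite mulr0; exact: (ideal0 iE).
  - by rewrite mulrDr; apply: idealD.
  - by rewrite mulrCA; apply: idealM.
by move=> v vl /=; rewrite mulrC; apply: adjoins_scale.
Qed.

End Ideals.

(** * Krull's principal ideal theorem and chains of primes *)

Section Krull.
Variable R : comNzRingType.
Hypothesis nR : noetherian R.
Implicit Types (A B C D P Q : set R) (a b r s x y : R) (l : seq R).

(* Krull's principal ideal theorem in [(R / P0)_P2].  If [P2] were minimal over
   [P0 + x], the ideals [D n], the contractions of [y ^ n] from the localization
   at [x], would become stationary modulo [x], hence stationary by Nakayama's
   lemma, and [y] would be invertible away from [x]. *)
Lemma krull_principal P0 P1 P2 x : is_prime P0 -> is_prime P1 -> is_prime P2 ->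
  P0 `<=` P1 -> ~ P1 `<=` P0 -> P1 `<=` P2 -> ~ P2 `<=` P1 -> P2 x ->
  exists Q, [/\ is_prime Q, P0 `<=` Q, Q x, Q `<=` P2 & ~ P2 `<=` Q].
Proof.
move=> p0 p1 p2 P01 nP10 P12 nP21 P2x.
have [P1x|nP1x] := pselect (P1 x); first by exists P1.
apply: contrapT => noQ.
have [y P1y nP0y] : exists2 y, P1 y & ~ P0 y.
  apply: contrapT => h; apply: nP10 => y P1y; apply: contrapT => nP0y.
  by apply: h; exists y.
have i0 : is_ideal P0 by case: p0.
have sT := @submodT R R^o.
pose aj A x := @adjoin R R^o setT A x.
have iaj A z : is_ideal A -> is_ideal (aj A z) by move=> iA; apply: submod_adjoin.
have Aaj A z : A `<=` aj A z by exact: (@sub_adjoin R R^o).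
have ajx A z : is_ideal A -> aj A z z.
  by move=> iA; exists 1, 0; split=> //; [exact: ideal0|rewrite /GRing.scale /= mulr1 addr0].
have m2 := prime_mult_closed p2.
pose S := [set t | exists s j, ~ P2 s /\ t = s * x ^+ j].
have mS : mult_closed S.
  split; first by exists 1, 0%N; rewrite mulr1; split=> //; case: p2.
  move=> _ _ [s [j [ns ->]]] [t [k [nt ->]]]; exists (s * t), (j + k)%N.
  by split; [exact: primeM|rewrite mulrACA exprD].
have Sx : S x by exists 1, 1%N; rewrite mul1r; split=> //; case: p2.
have SP2 s : ~ P2 s -> S s by move=> ns; exists s, 0%N; rewrite mulr1.
pose D n := satur S (aj P0 (y ^+ n)).
have sD n : saturated S (D n) by apply: saturated_satur => //; apply: iaj.
have iD n : is_ideal (D n) by case: (sD n).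
have DS n : D n.+1 `<=` D n.
  apply: saturS => _ [z [b [_ P0b ->]]]; exists (y * z), b; split=> //.
  by rewrite /GRing.scale /= exprSr mulrA.
have P0D n : P0 `<=` D n.
  by apply: subset_trans (Aaj _ _) _; apply: sub_satur.
pose A0 := satur (~` P2) (aj P0 x).
have fc : finite_colength P2 A0.
  apply: finite_colength_minimal => //; last exact: saturated_satur (iaj _ _ _).
  move=> Q pQ A0Q QP2; apply: contrapT => nP2Q; apply: noQ; exists Q.
  have ajQ : aj P0 x `<=` Q by apply: subset_trans A0Q; apply: sub_satur.
  by split=> // [|]; [apply: subset_trans ajQ; exact: Aaj|apply/ajQ/ajx].
pose D' n := satur (~` P2) (aj (D n) x).
have [|||N hN] := @finite_colength_dcc _ P2 A0 D' p2 fc.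
- by move=> n; apply: saturated_satur => //; apply: iaj; apply: iD.
- by move=> n; apply: saturS => _ [z [c [_ /(P0D n) Dc ->]]]; exists z, c.
- by move=> n; apply: saturS => _ [z [c [_ /DS Dc ->]]]; exists z, c.
have [l el] := noetherian_fg nR (iD N).
have i2 : is_ideal P2 by case: p2.
have iDN := iD N.+1.
(* Up to factors outside [P2], [D N] lies in [D N.+1 + x D N]: the coefficient [c] of [x] is in
   [D N] because [x] belongs to [S]. *)
have DN : D N `<=` D N.+1.
  rewrite el; apply: idl_sub => // v vl; move: v vl; apply: (nakayama p2).
    by split=> [|s a ns]; [exact: iD|case: (sD N.+1) => _; apply; exact: SP2].
  move=> v vl; have DNv : D N v by rewrite el; apply: mem_idl.
  have [|s ns [c [b [_ Db e]]]] := hN N (leqnn _) v.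
    by apply: sub_satur => //; apply: (Aaj (D N)).
  exists s => //; rewrite e; apply: idealD.
  - by apply: submod_adjoins.
  - apply: adjoins_mul => //.
    rewrite -el; case: (sD N) => _ /(_ x c Sx); apply.
    have -> : x * c = s * v - b by rewrite e addrK.
    by apply: idealB => //; [apply: idealM|apply: DS].
  - exact: (@sub_adjoins R R^o).
(* This puts [y^N (s x^j - z y)] in [P0], hence [s x^j] in [P1], although [s] and [x] lie outside
   [P1]. *)
have : D N.+1 (y ^+ N) by apply: DN; apply: sub_satur => //; apply: ajx.
case=> _ [s [j [ns ->]]] [z [b [_ P0b e]]].
have : P0 (y ^+ N * (s * x ^+ j - z * y)).
  rewrite mulrBr [_ * (s * _)]mulrC e /GRing.scale /= exprSr mulrA.
  rewrite [y ^+ N * z]mulrC -!mulrA [y * z]mulrC [X in _ - X]mulrCA [z * y]mulrC.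
  by rewrite addrAC subrr add0r.
case: (p0) => _ _ h /h[/(primeX p0 nP0y) //|/P01 h1].
have : P1 (s * x ^+ j).
  by apply: (idealBl _ _ h1); [case: p1|apply: idealM => //; case: p1].
by apply: primeM => //; [move/P12|apply: primeX].
Qed.

Fixpoint prime_chain n Q (T : set R) : Prop :=
  if n is n'.+1 then
    exists Q', [/\ is_prime Q', Q `<=` Q', ~ Q' `<=` Q & prime_chain n' Q' T]
  else Q = T.

Lemma prime_chain_sub n Q T : prime_chain n Q T -> Q `<=` T.
Proof.
elim: n Q => [Q ->//|n IH Q [Q' [_ h _ /IH]]]; exact: subset_trans.
Qed.

(** One step of the chain is traded for [x]. By induction the part above [Q1] can be made to start,
    one step shorter, at some [Q2] containing [x]; the principal ideal theorem between [Q] and [Q2]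
    then replaces [Q1]. *)
Lemma prime_chain_adjoin n Q T x : is_prime Q -> prime_chain n.+1 Q T -> T x ->
  exists Q', [/\ is_prime Q', Q `<=` Q', Q' x & prime_chain n Q' T].
Proof.
elim: n Q => [|n IH] Q pQ [Q1 [pQ1 QQ1 nQ1Q c]] Tx.
  by exists Q1; split=> //; rewrite c.
have [Q2 [pQ2 Q12 Q2x c2]] := IH Q1 pQ1 c Tx.
have [Q1x|nQ1x] := pselect (Q1 x); first by exists Q1.
have [|Q' [pQ' QQ' Q'x Q'2 n2]] := krull_principal pQ pQ1 pQ2 QQ1 nQ1Q Q12 _ Q2x.
  by move=> /(_ x Q2x).
by exists Q'; split=> //; exists Q2.
Qed.

(** Krull's height theorem in [R / Q], for [T] the least prime over [Q] and [l]: each element of [l]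
    shortens the chain by at most one step. *)
Lemma prime_chain_le n Q T l : is_prime Q -> prime_chain n Q T ->
  (forall x, x \in l -> T x) ->
  (forall P, is_prime P -> Q `<=` P -> (forall x, x \in l -> P x) -> T `<=` P) ->
  (n <= size l)%N.
Proof.
elim: n Q l => // n IH Q [|x l] pQ c lT h.
  case: c => Q' [_ _ nQ'Q /prime_chain_sub Q'T]; case: nQ'Q.
  by apply: (subset_trans Q'T); apply: h.
have [Q' [pQ' QQ' Q'x c']] := prime_chain_adjoin pQ c (lT x (mem_head _ _)).
apply: (IH Q') => // [y yl|P pP Q'P lP]; first by apply: lT; rewrite inE yl orbT.
apply: h => //; first exact: subset_trans Q'P.
by move=> y; rewrite inE => /orP[/eqP ->|/lP //]; apply: Q'P.
Qed.

Lemma prime_chain_adjoins n Q T l : is_prime Q ->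
  prime_chain (size l + n) Q T -> (forall x, x \in l -> T x) ->
  exists Q', [/\ is_prime Q', Q `<=` Q', forall x, x \in l -> Q' x &
                 prime_chain n Q' T].
Proof.
elim: l Q => [|x l IH] Q pQ c lT; first by exists Q; split=> // x; rewrite in_nil.
have [Q' [pQ' QQ' Q'x c']] := prime_chain_adjoin pQ c (lT x (mem_head _ _)).
have [|Q2 [pQ2 Q'Q2 lQ2 c2]] := IH Q' pQ' c'.
  by move=> y yl; apply: lT; rewrite inE yl orbT.
exists Q2; split=> //; first exact: subset_trans Q'Q2.
by move=> y; rewrite inE => /orP[/eqP ->|/lQ2 //]; apply: Q'Q2.
Qed.

End Krull.

(** * Regular systems of parameters *)

Section LocalRing.
Variables (R : comNzRingType) (m : idealr R).
Hypotheses (nR : noetherian R) (lm : local_ring m).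
Implicit Types (A Q : set R) (x y : R) (l q t u w : seq R).
Local Notation M := [set` m].

Lemma idealr_ideal (I : idealr R) : is_ideal [set` I].
Proof.
apply: ideal_intro => [|u v /= hu hv|a u /= hu] /=; first exact: rpred0.
  exact: rpredD.
exact: idealMr.
Qed.

Lemma prime_idealr_prime (P : prime_idealr R) : is_prime [set` P].
Proof.
split; [exact: idealr_ideal|by rewrite /= idealr1|move=> a b /=].
by rewrite prime_idealrM => /orP.
Qed.

Lemma proper_sub_maximal A : is_ideal A -> ~ A 1 -> A `<=` M.
Proof.
move=> iA nA1.
pose F := [set B : set R | is_ideal B /\ ~ B 1].
have [||B [[iB nB1] AB maxB]] := @noetherian_max _ F A nR.
- by move=> B [].
- by split.
pose pB : {pred R} := fun x => `[< B x >].
have pBE x : (x \in pB) = `[< B x >] by [].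
have cB : idealr_closed pB.
  split; rewrite ?pBE.
  - by apply/asboolP; apply: ideal0.
  - by apply/asboolP.
  - move=> a u v; rewrite !pBE => /asboolP Bu /asboolP Bv; apply/asboolP.
    by apply: idealD => //; apply: idealM.
pose B' : idealr R := HB.pack pB (isIdealr.Build R pB cB).
have maxB' : maximal_ideal B'.
  move=> I BI x xI; rewrite pBE; apply/asboolP; apply: (maxB [set` I]) => //.
    by split; [exact: idealr_ideal|rewrite /= idealr1].
  by move=> z Bz; apply: BI; rewrite pBE; apply/asboolP.
move=> x /AB Bx /=; rewrite -(lm.2 _ maxB') pBE; exact/asboolP.
Qed.

Lemma maximal_unit x : ~ M x -> exists y, y * x = 1.
Proof.
move=> nMx; apply: contrapT => nu; apply: nMx.
apply: (proper_sub_maximal (idl_ideal [:: x])); last by apply: mem_idl; apply: mem_head.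
by case=> z [_ [_ -> e]]; apply: nu; exists z; move: e; rewrite addr0 mulrC => ->.
Qed.

Lemma maximal_prime : is_prime M.
Proof.
split; [exact: idealr_ideal|by rewrite /= idealr1|move=> a b Mab].
have [|/maximal_unit[c e]] := pselect (M a); [by left|right].
rewrite -[b]mul1r -e -mulrA; exact: idealM (idealr_ideal m) Mab.
Qed.

Lemma saturated_local A : is_ideal A -> saturated (~` M) A.
Proof.
move=> iA; split=> // s a /maximal_unit[t e] As.
by rewrite -[a]mul1r -e -mulrA; apply: idealM.
Qed.

Lemma krull_dim_chain d : krull_dim R d ->
  exists2 Q, is_prime Q & prime_chain d Q M.
Proof.
case=> -[P hP] _.
(* The last prime of the given chain is replaced by [M], which contains it. *)
pose c k := if (k < d)%N then [set` P (inord k)] else M.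
have pc k : is_prime (c k).
  by rewrite /c; case: ifP => _; [exact: prime_idealr_prime|exact: maximal_prime].
have PM k : [set` P k] `<=` M.
  by have [? ? _] := prime_idealr_prime (P k); apply: proper_sub_maximal.
have cS k : (k < d)%N -> c k `<=` c k.+1 /\ ~ c k.+1 `<=` c k.
  move=> kd; rewrite {1 4}/c kd /c.
  have [h1 h2] : {subset P (inord k) <= P (inord k.+1)} /\
      ~ {subset P (inord k.+1) <= P (inord k)}.
    by apply: hP; rewrite !inordK ?ltnS // ltnW.
  case: ifP => _; first by split=> [x /h1|h]; [|apply: h2 => x; apply: h].
  by split=> [|h]; [exact: PM|apply: h2 => x; move/(PM (inord k.+1)); apply: h].
have chain n k : (k + n)%N = d -> prime_chain n (c k) M.
  elim: n k => [|n IH] k e; first by rewrite /c ifF // -e addn0 ltnn.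
  have kd : (k < d)%N by rewrite -e addnS ltnS leq_addr.
  have [h1 h2] := cS k kd; exists (c k.+1); split=> //.
  by apply: IH; rewrite addSnnS.
by exists (c 0%N) => //; apply: chain.
Qed.

(** * Prefixes of a regular system of parameters, and exchange of generators *)

Section Dimension.
Variable Q0 : set R.
Hypothesis pQ0 : is_prime Q0.

Lemma prime_chain_gen l n : prime_chain n Q0 M -> idl l = M -> (n <= size l)%N.
Proof.
move=> c lM; apply: (prime_chain_le nR pQ0 c).
  by move=> x xl; rewrite -lM; apply: mem_idl.
by move=> P pP _ lP; rewrite -lM; apply: idl_sub => //; case: pP.
Qed.

(** Descending induction on the prefix: let [(q, x)] be prime. A prime [Q] containing [q], with a
    chain of [size l + 1] steps up to [M], omits [x] and lies in [(q, x)] by counting steps. Hence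
    [Q = (q) + x Q], and Nakayama gives [Q = (q)]. *)
Lemma rsop_prefix_prime l q :
  prime_chain (size (q ++ l)) Q0 M -> idl (q ++ l) = M ->
  is_prime (idl q) /\ forall x l', l = x :: l' -> ~ idl q x.
Proof.
elim: l q => [|x l IH] q c qlM.
  by split=> //; rewrite cats0 in qlM; rewrite qlM; apply: maximal_prime.
have [|| pqx _] := IH (rcons q x); rewrite ?cat_rcons //.
have xlM y : y \in x :: l -> M y.
  by move=> yl; rewrite -qlM; apply: mem_idl; rewrite mem_cat yl orbT.
have qM y : y \in q -> M y.
  by move=> yl; rewrite -qlM; apply: mem_idl; rewrite mem_cat yl.
rewrite size_cat in c.
have [Q [pQ _ qQ cQ]] := prime_chain_adjoins nR pQ0 c qM.
have iQ : is_ideal Q by case: pQ.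
have noc : ~ prime_chain (size l).+1 (idl (rcons q x)) M.
  move=> c'; have := prime_chain_le nR (l := l) pqx c'; rewrite ltnn.
  move=> h; suff: false by []; apply: h.
    by move=> y yl; apply: xlM; rewrite inE yl orbT.
  move=> P pP qxP lP; rewrite -qlM -cat_rcons; apply: idl_sub; first by case: pP.
  by move=> y; rewrite mem_cat => /orP[yq|/lP //]; apply/qxP/mem_idl.
have Mx : M x by apply: xlM; apply: mem_head.
have [Q1 [pQ1 QQ1 Q1x c1]] := prime_chain_adjoin nR pQ cQ Mx.
have qxQ1 : idl (rcons q x) `<=` Q1.
  apply: idl_sub; first by case: pQ1.
  by move=> y; rewrite mem_rcons inE => /orP[/eqP ->//|/qQ /QQ1].
have Q1qx : Q1 `<=` idl (rcons q x).
  by apply: contrapT => h; apply: noc; exists Q1.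
have nQx : ~ Q x.
  move=> Qx; apply: noc.
  rewrite (_ : idl _ = Q) //; apply/seteqP; split; last exact: subset_trans Q1qx.
  by apply: idl_sub => // y; rewrite mem_rcons inE => /orP[/eqP ->//|/qQ].
have qsubQ : idl q `<=` Q by apply: idl_sub.
have [g eg] := noetherian_fg nR iQ.
have eQ : idl q = Q.
  apply/seteqP; split=> //; rewrite eg; apply: idl_sub; first exact: idl_ideal.
  apply: (nakayama maximal_prime); first exact/saturated_local/idl_ideal.
  move=> v vg; exists 1; first by rewrite /= idealr1.
  have Qv : Q v by rewrite eg; apply: mem_idl.
  have := Q1qx _ (QQ1 _ Qv); rewrite -idl_adjoin => -[z [b [_ qb e]]].
  rewrite mul1r e; apply: idealD.
  - by apply: submod_adjoins; [exact: idealr_ideal|exact: idl_ideal].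
  - rewrite /GRing.scale /=; apply: adjoins_mul => //; try exact: idealr_ideal.
      exact: idl_ideal.
    rewrite -eg; case: (pQ) => _ _ /(_ x z) [|//|//].
    have -> : x * z = v - b by rewrite e addrK.
    by apply: idealB => //; apply: qsubQ.
  - by apply: (@sub_adjoins R R^o) => //; exact: idealr_ideal.
by rewrite eQ; split=> // y l' [<- _].
Qed.

Lemma exchange_step q w y : idl (q ++ w) y ->
  (exists w1 v w2 c e, [/\ w = w1 ++ v :: w2, ~ M c, idl (q ++ w1 ++ w2) e &
                           y = c * v + e]) \/
  @adjoins R R^o M (idl q) w y.
Proof.
elim: w y => [|v w IH] y; first by rewrite cats0; right.
have sub : idl (q ++ v :: w) `<=` @adjoin R R^o setT (idl (q ++ w)) v.
  rewrite idl_adjoin; apply: idl_subl => x xl; apply: mem_idl.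
  by move: xl; rewrite mem_rcons !(mem_cat, inE) orbCA.
move=> /sub[c [e [_ he ->]]]; rewrite /GRing.scale /= [v * c]mulrC.
have [Mc|nMc] := pselect (M c); last by left; exists [::], v, w, c, e.
case: (IH e he) => [[w1 [v' [w2 [c' [e' [-> nc' he' ->]]]]]]|h].
  left; exists (v :: w1), v', w2, c', (c * v + e'); split=> //; last by rewrite addrCA.
  apply: idealD; first exact: idl_ideal.
    by apply: idealM; [exact: idl_ideal|apply: mem_idl; rewrite !(mem_cat, inE) eqxx orbT].
  move: he'; apply: idl_subl => x; rewrite !(mem_cat, inE) => xl.
  by apply: mem_idl; rewrite !(mem_cat, inE) -orbA orbCA xl orbT.
by right; exists c, e; split=> //; rewrite mulrC.
Qed.

(** Steinitz exchange: the elements of [r] enter the list of generators of [(t)] one at a time, each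
    replacing an element of [w] on which it has a unit coefficient. *)
Lemma rsop_exchange r q w t u' :
  prime_chain (size ((q ++ r) ++ u')) Q0 M -> idl ((q ++ r) ++ u') = M ->
  idl t `<=` M -> (forall x, x \in r -> idl t x) ->
  idl (q ++ w) = idl t -> size (q ++ w) = size t ->
  exists2 w', idl ((q ++ r) ++ w') = idl t & size ((q ++ r) ++ w') = size t.
Proof.
move=> + + tM; elim: r q w => [|y r IH] q w c gM rt et st.
  by exists w; rewrite cats0.
rewrite -cat_rcons in c gM *.
have ty : idl t y by apply: rt; apply: mem_head.
have : idl (q ++ w) y by rewrite et.
move=> /exchange_step[[w1 [v [w2 [a [e [ew na he ey]]]]]]|h].
  apply: (IH (rcons q y) (w1 ++ w2)) => //.
  - by move=> x xr; apply: rt; rewrite inE xr orbT.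
  - rewrite -et; apply/seteqP; split; apply: idl_subl => x.
      rewrite mem_cat mem_rcons inE -orbA => /orP[/eqP ->|xl]; first by rewrite et.
      apply: mem_idl; move: xl.
      by rewrite ew !(mem_cat, inE) => /or3P[]->; rewrite ?orbT.
    have [->|xv] := eqVneq x v; last first.
      rewrite ew !(mem_cat, inE) (negPf xv) /= => xl; apply: mem_idl.
      by rewrite !(mem_cat, mem_rcons, inE) -orbA xl orbT.
    move=> _; have [b eb] := maximal_unit na.
    have -> : v = b * (y - e) by rewrite ey addrK mulrA eb mul1r.
    apply: idealM; first exact: idl_ideal.
    apply: idealB; first exact: idl_ideal.
      by apply: mem_idl; rewrite mem_cat mem_rcons mem_head.
    move: he; apply: idl_subl => z zl; apply: mem_idl.
    by move: zl; rewrite !(mem_cat, mem_rcons, inE) -orbA => ->; rewrite orbT.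
  - by rewrite -st ew !size_cat size_rcons /= addSn !addnS.
(* Without a unit coefficient, [y] lies in [(q) + M w] with [w] in [M = N + (y)], so in [N + M y].
   By Nakayama [y] lies in [N], and [M] has fewer generators than a chain of primes below it has
   steps. *)
pose N := idl ((q ++ r) ++ u').
have iN : is_ideal N by apply: idl_ideal.
have gM' : idl (rcons ((q ++ r) ++ u') y) = M.
  rewrite -gM; apply/seteqP; split; apply: idl_subl => x xl; apply: mem_idl; move: xl;
    by rewrite !(mem_cat, mem_rcons, inE) -!orbA.
have iM := idealr_ideal m.
have Ny : N y.
  apply: (@nakayama _ M N [:: y] maximal_prime) (mem_head _ _).
    exact: saturated_local.
  move=> x; rewrite inE => /eqP ->; exists 1; first by rewrite /= idealr1.
  rewrite mul1r; move: y h {c gM rt ty IH} gM' => y h gM'.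
  have iE : is_ideal (@adjoins R R^o M N [:: y]) by apply: submod_adjoins.
  move: h; apply: adjoins_sub => //.
    apply: (@subset_trans _ N); last exact: (@sub_adjoins R R^o).
    by apply: idl_subl => z zq; apply: mem_idl; rewrite !mem_cat zq.
  move=> z c zw Mc; have Mz : M z.
    by apply: tM; rewrite -et; apply: mem_idl; rewrite mem_cat zw orbT.
  have [a [b [_ Nb ->]]] : @adjoin R R^o setT N y z by rewrite idl_adjoin gM'.
  exists (c * a), (c * b); split; [exact: (idealMl (A := M) a iM Mc)|exact: idealM|].
  by rewrite /GRing.scale /= mulrDl [y * _]mulrC -mulrA [in LHS]mulrC mulrA (mulrC b).
have NM : N = M.
  rewrite -gM'; apply/seteqP; split; apply: idl_subl => x.
    by move=> xl; apply: mem_idl; rewrite mem_rcons inE xl orbT.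
  by rewrite mem_rcons inE => /orP[/eqP -> //|]; apply: mem_idl.
have := prime_chain_gen c NM.
by rewrite !size_cat size_rcons !addSn ltnn.
Qed.

End Dimension.
End LocalRing.

(** * Cohomology of the torsion of a complex *)

Section Divisible.
Variables (R : comNzRingType) (V V' : lmodType R).

(* [M / B'] is the union of the images under [d] of the [g] with
   [x ^ k *: g \in Z], and multiplication by [x ^ k] identifies the [k]-th of
   these with [Z / (C + x ^ k Z)]. *)
Lemma wreg_torsion_quotient (d : {linear V -> V'}) (D Z C : set V)
    (B' : set V') x q :
  submod D -> submod Z -> submod C -> submod B' -> Z `<=` D -> C `<=` Z ->
  (forall k e, D e -> exists2 e', D e' & x ^+ k *: e' = e) ->
  wreg Z C (x :: q) ->
  B' `<=` [set d g | g in [set g | D g /\ exists k, Z (x ^+ k *: g)]] ->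
  (forall g k, D g -> Z (x ^+ k *: g) ->
     B' (d g) <-> adjoin Z C (x ^+ k) (x ^+ k *: g)) ->
  wreg [set d g | g in [set g | D g /\ exists k, Z (x ^+ k *: g)]] B' q.
Proof.
move=> sD sZ sC sB' ZD CZ divD w B'M B'E.
pose G k := [set g | D g /\ Z (x ^+ k *: g)].
pose K k := [set g | G k g /\ adjoin Z C (x ^+ k) (x ^+ k *: g)].
have sA k : submod (adjoin Z C (x ^+ k)) by apply: submod_adjoin.
have sG k : submod (G k).
  split; first by split; [exact: submod0|rewrite scaler0; exact: submod0].
  move=> a u v [Du Zu] [Dv Zv]; split; first by case: sD => _; apply.
  by rewrite scalerDr scalerA mulrC -scalerA; case: sZ => _; apply.
have sK k : submod (K k).
  split; first by split; [exact: submod0|rewrite scaler0; exact: submod0].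
  move=> a u v [Gu Au] [Gv Av]; split; first by case: (sG k) => _; apply.
  by rewrite scalerDr scalerA mulrC -scalerA; case: (sA k) => _; apply.
have GS k : G k `<=` G k.+1.
  by move=> g [Dg Zg]; split=> //; rewrite exprS -scalerA; apply: submodZ.
have simg (A : set V) : submod A -> submod [set d g | g in A].
  move=> [A0 AD]; split; first by exists 0 => //; rewrite linear0.
  by move=> a _ _ [u Au <-] [v Av <-]; exists (a *: u + v); [exact: AD|rewrite linearP].
pose Mk k := [set d g | g in G k].
pose Bk k := [set v | Mk k v /\ B' v].
have -> : [set d g | g in [set g | D g /\ exists k, Z (x ^+ k *: g)]] = \bigcup_k Mk k.
  apply/seteqP; split=> [_ [g [Dg [k Zg]] <-]|_ [k _ [g [Dg Zg] <-]]].
    by exists k => //; exists g.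
  by exists g => //; split=> //; exists k.
have -> : B' = \bigcup_k Bk k.
  apply/seteqP; split=> [v B'v|v [k _ [_ h]] //].
  have [g [Dg [k Zg]] e] := B'M v B'v; exists k => //; split=> //; by exists g.
have sB k : submod (Bk k).
  have [h0 hD] := simg _ (sG k); have [h0' hD'] := sB'.
  by split=> [//|a u v [? ?] [? ?]]; split; [exact: hD|exact: hD'].
apply: wreg_bigcup => //.
- by move=> k; apply: simg.
- by move=> k _ [g Gg <-]; exists g => //; apply: GS.
- by move=> k v [[g Gg e] B'v]; split=> //; exists g => //; apply: GS.
move=> k; have hGK : wreg (G k) (K k) q.
  apply/(@wreg_iso _ _ _ (x ^+ k \*: idfun) _ _ Z (adjoin Z C (x ^+ k)) q) => //.
  - by move=> g [].
  - move=> z Zz; have [e' De' e] := divD k z (ZD _ Zz); exists e'; first by split; rewrite ?e.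
    by rewrite /= e subrr; apply: submod0.
  - by move=> g Gg; split=> [h|[]].
  - exact: wreg_adjoin_expr.
apply/(@wreg_iso _ _ _ d (G k) (K k) (Mk k) (Bk k) q) => //.
- exact: simg.
- by move=> g Gg; exists g.
- by move=> _ [g Gg <-]; exists g => //; rewrite subrr; apply: submod0.
- move=> g Gg; have [Dg Zg] := Gg; have h := B'E g k Dg Zg; split.
    by move=> [_ /h hA].
  by move=> [_ /h hB]; split=> //; exists g.
Qed.

End Divisible.

Section Complex.
Variables (R : comNzRingType) (E : nat -> lmodType R).
Variable d : forall n, {linear E n -> E n.+1}.
Hypothesis dd : forall n x, d n.+1 (d n x) = 0.
Implicit Types (l q : seq R) (x y : R) (n : nat).

Definition ptorsion l n : set (E n) :=
  [set e | forall x, x \in l -> exists k, x ^+ k *: e = 0].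

Definition pcocycle l n : set (E n) := [set e | ptorsion l e /\ d n e = 0].

Definition pboundary l n : set (E n) :=
  match n with 0 => [set 0] | k.+1 => [set d k e | e in @ptorsion l k] end.

(** For the [l]-torsion [T] this makes [T -> T_x] surjective, with kernel the torsion for
    [rcons l x]; the section below makes the resulting long exact sequence explicit. *)
Definition divisible l x : Prop := forall n (e : E n), ptorsion l e ->
  exists2 e', @ptorsion l n e' & x *: e' = e.

Lemma expr_kill (V : lmodType R) x k j (e : V) :
  (k <= j)%N -> x ^+ k *: e = 0 -> x ^+ j *: e = 0.
Proof. by move=> /subnK <- h; rewrite exprD -scalerA h scaler0. Qed.

Lemma submod_ptorsion l n : submod (@ptorsion l n).
Proof.
split=> [x _|a u v hu hv x xl]; first by exists 0%N; rewrite scaler0.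
have [[k ek] [j ej]] := (hu x xl, hv x xl); exists (k + j)%N.
rewrite scalerDr (expr_kill _ ej) ?leq_addl // scalerA mulrC -scalerA.
by rewrite (expr_kill _ ek) ?leq_addr // scaler0 addr0.
Qed.

Lemma submod_pcocycle l n : submod (@pcocycle l n).
Proof.
have [h0 hD] := submod_ptorsion l n.
split=> [|a u v [hu eu] [hv ev]]; first by split=> //; rewrite linear0.
by split; [exact: hD|rewrite linearP /= eu ev scaler0 addr0].
Qed.

Lemma submod_pboundary l n : submod (@pboundary l n).
Proof.
case: n => [|n]; first exact: submod_set0.
have [h0 hD] := submod_ptorsion l n.
split=> [|a _ _ [u hu <-] [v hv <-]]; first by exists 0 => //; rewrite linear0.
by exists (a *: u + v); [exact: hD|rewrite linearP].
Qed.

Lemma ptorsion_d l n (e : E n) : ptorsion l e -> ptorsion l (d n e).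
Proof. by move=> h x /h[k ek]; exists k; rewrite -linearZ ek linear0. Qed.

Lemma pboundary_cocycle l n : @pboundary l n `<=` @pcocycle l n.
Proof.
case: n => [|n] /=; first by move=> _ ->; exact: submod0 (submod_pcocycle l 0).
by move=> _ [e he <-]; split; [exact: ptorsion_d|exact: dd].
Qed.

Lemma ptorsion_rcons l x n (e : E n) :
  ptorsion (rcons l x) e <-> ptorsion l e /\ exists k, x ^+ k *: e = 0.
Proof.
split=> [h|[h hx] y]; last by rewrite mem_rcons inE => /orP[/eqP ->|/h].
by split=> [y yl|]; apply: h; rewrite mem_rcons inE ?eqxx ?yl ?orbT.
Qed.

Lemma divisible_expr l x k n (e : E n) : divisible l x -> ptorsion l e ->
  exists2 e', @ptorsion l n e' & x ^+ k *: e' = e.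
Proof.
move=> div; elim: k e => [|k IH] e he; first by exists e => //; rewrite scale1r.
have [e1 he1 <-] := div n e he; have [e2 he2 <-] := IH e1 he1.
by exists e2 => //; rewrite exprS scalerA.
Qed.

(** * Passing from the [l]-torsion to the torsion for one more element *)

Section Step.
Variables (l : seq R) (x : R).
Hypothesis div : divisible l x.
Local Notation lx := (rcons l x).

(** Modulo [pboundary lx] this is the kernel of the map from [H^n] of the [lx]-torsion to [H^n] of
    the [l]-torsion. *)
Definition pmiddle n : set (E n) := [set z | @pcocycle lx n z /\ @pboundary l n z].

Lemma submod_pmiddle n : submod (@pmiddle n).
Proof.
have [h0 hD] := submod_pcocycle lx n; have [h0' hD'] := submod_pboundary l n.
by split=> [//|a u v [? ?] [? ?]]; split; [exact: hD|exact: hD'].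
Qed.

Lemma pboundary_middle n : @pboundary lx n `<=` @pmiddle n.
Proof.
move=> z hz; split; first exact: pboundary_cocycle.
case: n z hz => [//|n] z /= [e /ptorsion_rcons[he _] <-]; by exists e.
Qed.

(** If [x^k g = d f], divide [f] by [x^k]: then [g - d f'] is killed by [x^k]. *)
Lemma lift_boundary n k (g : E n) : ptorsion l g ->
  @pboundary l n (x ^+ k *: g) ->
  exists2 b, @pboundary l n b & ptorsion lx (g - b).
Proof.
case: n g => [|n] g hg /=.
  move=> e; exists 0 => //; rewrite subr0; apply/ptorsion_rcons; split=> //.
  by exists k.
move=> [f hf e]; have [f' hf' ef] := divisible_expr k div hf.
exists (d n f'); first by exists f'.
apply/ptorsion_rcons; split.
  by apply: (submodB (submod_ptorsion l n.+1) hg); apply: ptorsion_d.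
by exists k; rewrite scalerBr -linearZ ef e subrr.
Qed.

Lemma pcocycle_sub n C q : submod C -> wreg (@pcocycle l n) C (x :: q) ->
  @pcocycle lx n `<=` C.
Proof.
move=> sC w z [/ptorsion_rcons[hz [k ek]] dz].
apply: (wreg_expr (n := k) (submod_pcocycle l n) w); first by split.
by rewrite ek; apply: submod0.
Qed.

Lemma wreg_cocycle_middle n C q q' : submod C ->
  @pboundary l n `<=` C -> C `<=` @pcocycle l n ->
  (forall c, C c -> exists k, @pboundary l n (x ^+ k *: c)) ->
  wreg (@pcocycle l n) C (x :: q') ->
  wreg C (@pboundary l n) q -> wreg (@pcocycle lx n) (@pmiddle n) q.
Proof.
move=> sC BC CZ tC w wq.
have sB := submod_pboundary l n.
apply/(@wreg_iso _ _ _ idfun (@pcocycle lx n) (@pmiddle n) C (@pboundary l n)) => //.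
- exact: submod_pcocycle.
- exact: submod_pmiddle.
- exact: pcocycle_sub w.
- move=> c Cc; have [k hk] := tC c Cc; have [hc dc] := CZ c Cc.
  have [b hb tb] := lift_boundary hc hk; exists (c - b).
    by split=> //; rewrite linearB dc (pboundary_cocycle hb).2 subr0.
  by rewrite /= opprB addrCA subrr addr0.
- by move=> z hz; split=> [h|[_ h]].
Qed.

(** The kernel in degree [n + 1] is the cokernel of [H -> H_x] for [H = Z / B] in degree [n]. Since
    [C / B] dies in [H_x], only [Z / C], on which [x] is regular, matters. *)
Lemma wreg_middle_boundary n C q : submod C ->
  @pboundary l n `<=` C -> C `<=` @pcocycle l n ->
  (forall c, C c -> exists k, @pboundary l n (x ^+ k *: c)) ->
  wreg (@pcocycle l n) C (x :: q) ->
  wreg (@pmiddle n.+1) (@pboundary lx n.+1) q.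
Proof.
move=> sC BC CZ tC w; have sZ := submod_pcocycle l n.
have sT := submod_ptorsion l n.
have -> : @pmiddle n.+1 = [set d n g | g in
    [set g | @ptorsion l n g /\ exists k, @pcocycle l n (x ^+ k *: g)]].
  apply/seteqP; split.
    move=> z [[/ptorsion_rcons[_ [k ek]] _] [g hg e]]; exists g => //; split=> //.
    exists k; split; first exact: (submodZ (A := @ptorsion l n) _ sT hg).
    by rewrite linearZ /= e ek.
  move=> _ [g [hg [k [_ dg]]] <-]; split; last by exists g.
  split; last exact: dd.
  by apply/ptorsion_rcons; split; [exact: ptorsion_d|exists k; rewrite -linearZ].
apply: (wreg_torsion_quotient (C := C)) => //.
- exact: submod_pboundary.
- by move=> e [].
- by move=> k e he; apply: divisible_expr.
- move=> _ [g /ptorsion_rcons[hg [k ek]] <-]; exists g => //; split=> //.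
  by exists k; rewrite ek; apply: submod0.
move=> g k hg Zg; split.
  move=> [t /ptorsion_rcons[ht [j ej]] e]; exists (g - t), (x ^+ k *: t).
  have Zgt : @pcocycle l n (g - t).
    by split; [exact: (submodB sT hg ht)|rewrite linearB e subrr].
  split=> //; last by rewrite scalerBr subrK.
  apply: (wreg_expr (n := j) sZ w).
    have -> : x ^+ k *: t = x ^+ k *: g - x ^+ k *: (g - t).
      by rewrite scalerBr opprB addrCA subrr addr0.
    by apply: submodB => //; apply: submodZ.
  by rewrite scalerA mulrC -scalerA ej scaler0; apply: submod0.
move=> [z [c [Zz Cc e]]].
have [j hj] := tC c Cc.
have hgz : ptorsion l (g - z) by apply: (submodB sT hg); case: Zz.
have [|b hb tb] := @lift_boundary n (j + k) (g - z) hgz.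
  by rewrite exprD -scalerA scalerBr e addrAC subrr add0r.
exists (g - z - b) => //; rewrite !linearB.
by rewrite Zz.2 (pboundary_cocycle hb).2 !subr0.
Qed.

(** Here [H^n] is [x]-torsion, so its localization vanishes and contributes nothing in degree
    [n + 1]. *)
Lemma pmiddle_boundary n : (forall c, @pcocycle l n c ->
    exists k, @pboundary l n (x ^+ k *: c)) ->
  @pmiddle n.+1 `<=` @pboundary lx n.+1.
Proof.
move=> tZ z [[/ptorsion_rcons[_ [k ek]] _] [g hg e]]; rewrite -{z}e in ek *.
have [|j hj] := tZ (x ^+ k *: g).
  split; first exact: (submodZ _ (submod_ptorsion l n) hg).
  by move: ek; rewrite -linearZ => ek.
rewrite scalerA -exprD in hj; have [b hb tb] := lift_boundary hg hj.
by exists (g - b) => //; rewrite linearB (pboundary_cocycle hb).2 subr0.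
Qed.

Lemma wreg_cohomology_step q :
  (forall n, wreg (@pcocycle l n) (@pboundary l n) (x :: q)) ->
  forall n, wreg (@pcocycle lx n) (@pboundary lx n) q.
Proof.
move=> w n.
have -> : @pcocycle lx n = @pmiddle n.
  apply/seteqP; split=> [z hz|z []//]; split=> //.
  by apply: (pcocycle_sub (submod_pboundary l n) (w n)).
case: n => [|n].
  apply: wreg_triv; [exact: submod_pmiddle|exact: submod_pboundary|].
  by move=> z [].
apply: (wreg_middle_boundary (C := @pboundary l n)) (w n) => //.
- exact: submod_pboundary.
- exact: pboundary_cocycle.
- by move=> c hc; exists 0%N; rewrite scale1r.
Qed.

End Step.

(* [H^n] of the [l]-torsion is an extension of the [rem]-torsion-free module
   [Z / C] by the [rem]-torsion module [C / B]; the submodule is everything in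
   degree [0], and vanishes from degree [2] on. *)
Record filtered l rem q (C : forall n, set (E n)) : Prop := Filtered {
  filt_submod : forall n, submod (C n);
  filt_sub : forall n, @pboundary l n `<=` C n;
  filt_cocycle : forall n, C n `<=` @pcocycle l n;
  filt_torsion : forall n c x, x \in rem -> C n c ->
    exists k, @pboundary l n (x ^+ k *: c);
  filt_reg : forall n, wreg (C n) (@pboundary l n) q;
  filt_quo : forall n, wreg (@pcocycle l n) (C n) (rem ++ q);
  filt0 : @pcocycle l 0 `<=` C 0%N;
  filt2 : forall n, C n.+2 `<=` @pboundary l n.+2 }.

Lemma filtered_step l x rem q C : divisible l x -> filtered l (x :: rem) q C ->
  exists C', filtered (rcons l x) rem q C'.
Proof.
move=> div [sC BC CZ tC rC qC C0 C2]; set lx := rcons l x.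
have tCx n c : C n c -> exists k, @pboundary l n (x ^+ k *: c).
  by move=> Cc; apply: tC => //; rewrite mem_head.
have sZ := submod_pcocycle lx; have sB := submod_pboundary lx.
have sM := submod_pmiddle l x.
have BZ := @pboundary_cocycle lx.
(* In degrees 0 and 1 only the torsion part [C / B] survives, since [H^0] is torsion; from degree 2
   on everything comes from [Z / C] one degree lower. *)
exists (fun n => if (n < 2)%N then @pcocycle lx n else @pboundary lx n).
have mid n : (n < 2)%N -> @pmiddle l x n `<=` @pboundary lx n.
  case: n => [_ z []//|[_|//]]; apply: pmiddle_boundary => // c /C0; exact: tCx.
split=> [n|n|n|n c y yr|n|n|//|n //].
- by case: ifP.
- by case: ifP => _; [exact: BZ|move=> z].
- by case: ifP => _; [move=> z|exact: BZ].
- case: ifP => [n2 hc|_ hc]; last by exists 0%N; rewrite scale1r.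
  have [|k hk] := tC n c y _ (pcocycle_sub (sC n) (qC n) hc).
    by rewrite inE yr orbT.
  by exists k; apply: mid => //; split=> //; apply: submodZ.
- case: ifP => [n2|_]; last exact: wreg_triv.
  apply: (wreg_ext (B := @pmiddle l x n)) => //.
  + exact: pboundary_middle.
  + by move=> z [].
  + apply: (wreg_cocycle_middle div (C := C n) (q' := rem ++ q)) => //; exact: tCx.
  + by apply: wreg_triv => //; apply: mid.
- case: ifP => [_|]; first exact: wreg_triv.
  case: n => [//|[//|n]] _.
  have -> : @pcocycle lx n.+2 = @pmiddle l x n.+2.
    apply/seteqP; split=> [z hz|z []//]; split=> //.
    by apply: C2; apply: (pcocycle_sub (sC n.+2) (qC n.+2)).
  apply: (wreg_middle_boundary div (C := C n.+1)) => //; exact: tCx.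
Qed.

Lemma filtered_wreg l q C n : filtered l [::] q C ->
  wreg (@pcocycle l n) (@pboundary l n) q.
Proof.
move=> [sC BC CZ _ rC qC _ _]; apply: (wreg_ext (B := C n)) => //.
- exact: submod_pcocycle.
- exact: submod_pboundary.
Qed.

(** * The torsion for the first parameter *)

Section Base.
Variables (J : set R) (x : R) (rem q : seq R) (f : {linear R^o -> E 0%N}).
Hypotheses (iJ : is_ideal J) (remJ : forall y, y \in x :: rem -> J y).
Hypothesis xreg : forall k r, x ^+ k * r = 0 -> r = 0.
Hypothesis f_inj : forall r, f r = 0 -> r = 0.
Hypothesis exact0 : forall e, d 0%N e = 0 <-> exists2 r, J r & f r = e.
Hypothesis exactS : forall n e, d n.+1 e = 0 -> exists e', d n e' = e.
Hypothesis div : forall n (e : E n), exists e', x *: e' = e.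
Hypothesis wR : @wreg R R^o setT [set 0] (x :: rem ++ q).
Hypothesis wJ : @wreg R R^o setT J q.

(** As [f] identifies [J] with the kernel of [d 0] and [x] is in [J], the only cohomology is
    [H^1 = J_x / J = R_x / J]. The classes of [d (f r)] form [C1], a copy of [R / J]; an element [g]
    with [x^k g = f r] stands for [r / x^k] in [R_x / R]. *)
Lemma filtered_base : exists C, filtered [:: x] rem q C.
Proof.
have divx : divisible [::] x by move=> n e _; have [e' <-] := div e; exists e'.
have T0 n (e : E n) : ptorsion [::] e by [].
have Jx : J x by apply: remJ; rewrite mem_head.
have f_sub k g : adjoin [set f r | r in setT] [set 0] (x ^+ k) (x ^+ k *: g) <->
    exists2 r, True & x ^+ k *: (g - f r) = 0.
  split=> [[_ [_ [[r _ <-] -> e]]]|[r _ e]].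
    by exists r => //; rewrite scalerBr e addr0 subrr.
  exists (f r), 0; split; [by exists r|by []|].
  by rewrite addr0; apply/eqP; rewrite -subr_eq0 -scalerBr e.
pose C1 : set (E 1%N) := [set v | exists r b, [/\ True, @pboundary [:: x] 1 b &
  v = d 0%N (f r) + b]].
have sZ := submod_pcocycle [:: x]; have sB := submod_pboundary [:: x].
have BZ := @pboundary_cocycle [:: x].
have df r : J r -> d 0%N (f r) = 0 by move=> Jr; apply/exact0; exists r.
have sC1 : submod C1.
  split; first by exists 0, 0; split=> //; [exact: submod0|rewrite !linear0 addr0].
  move=> a _ _ [r [b [_ hb ->]]] [r' [b' [_ hb' ->]]].
  exists (a *: r + r'), (a *: b + b'); split=> //; first by case: (sB 1%N) => _; apply.
  by rewrite !linearP scalerDr addrACA.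
have BC1 : @pboundary [:: x] 1 `<=` C1.
  by move=> b hb; exists 0, b; rewrite !linear0 add0r.
have C1E g : C1 (d 0%N g) <-> exists k r, x ^+ k *: (g - f r) = 0.
  split=> [[r [_ [_ [t ht <-] e]]]|[k [r e]]].
    have /exact0[j Jj ej] : d 0%N (g - f r - t) = 0.
      by rewrite !linearB e addrAC addrK subrr.
    have [k ek] := ht x (mem_head _ _); exists k, (r + j).
    have -> : g - f (r + j) = t; last by [].
    by rewrite linearD ej addrA [f r + _]addrCA subrr addr0 opprB addrCA subrr addr0.
  exists r, (d 0%N (g - f r)); split=> //; last by rewrite linearB addrCA subrr addr0.
  by exists (g - f r) => // y; rewrite inE => /eqP ->; exists k.
have C1Z : C1 `<=` @pcocycle [:: x] 1.
  move=> _ [r [b [_ hb ->]]]; apply: submodD; [exact: sZ| |exact: BZ].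
  split; last exact: dd.
  move=> y; rewrite inE => /eqP ->; exists 1%N.
  by rewrite expr1 -!linearZ; apply: df; apply: idealMl.
have Z0 : @pcocycle [:: x] 0 `<=` [set 0].
  move=> e [te /exact0[r _ er]]; have [k] := te x (mem_head _ _).
  by rewrite -er -linearZ => /f_inj /xreg ->; rewrite /= linear0.
have Z2 n : @pcocycle [:: x] n.+2 `<=` @pboundary [:: x] n.+2.
  move=> z [tz /exactS[g eg]]; rewrite -eg.
  have [] // := @pmiddle_boundary [::] x divx n.+1 _ (d n.+1 g).
  - move=> c [_ /exactS[c' ec]]; exists 0%N; rewrite scale1r.
    by exists c'.
  - by split; [split; [rewrite eg|exact: dd]|exists g].
  - by move=> t ht e; exists t.
exists (fun n => match n with 0 => @pcocycle [:: x] 0 | 1 => C1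
  | n.+2 => @pboundary [:: x] n.+2 end).
split=> //.
- by case=> [|[|n]].
- by case=> [|[|n]] //; apply: BZ.
- by case=> [|[|n]] //; apply: BZ.
- move=> n c y yr; case: n c => [|[|n]] c.
  + by move=> /Z0 ->; exists 0%N; rewrite scale1r.
  + move=> [r [b [_ hb ->]]]; exists 1%N; rewrite expr1 scalerDr -!linearZ df ?add0r.
      exact: submodZ.
    by apply: idealMl => //; apply: remJ; rewrite inE yr orbT.
  + by move=> h; exists 0%N; rewrite scale1r.
- case=> [|[|n]]; try by apply: wreg_triv.
  apply/(@wreg_iso _ _ _ (d 0%N \o f) setT J C1 (@pboundary [:: x] 1)) => //.
  + by move=> r _; exists r, 0; split; [|exact: (submod0 (sB 1%N))|rewrite addr0].
  + by move=> _ [r [b [_ hb ->]]]; exists r => //; rewrite /= addrAC subrr add0r.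
  + move=> r _; split=> [[t ht e]|/df /= ->]; last exact: (submod0 (sB 1%N)).
    have /exact0[j Jj ej] : d 0%N (f r - t) = 0 by rewrite linearB e subrr.
    have [k ek] := ht x (mem_head _ _).
    suff -> : r = j by [].
    apply/eqP; rewrite -subr_eq0; apply/eqP/(xreg (k := k))/f_inj.
    by rewrite linearZ linearB ej opprB addrCA subrr addr0.
- case=> [|[|n]]; try by apply: wreg_triv.
  have -> : @pcocycle [:: x] 1 = [set d 0%N g | g in
      [set g | setT g /\ exists k, [set f r | r in setT] (x ^+ k *: g)]].
    apply/seteqP; split.
      move=> z [tz /exactS[g eg]]; exists g => //; split=> //.
      have [k ek] := tz x (mem_head _ _); exists k.
      have /exact0[r _ er] : d 0%N (x ^+ k *: g) = 0 by rewrite linearZ /= eg.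
      by exists r.
    move=> _ [g [_ [k [r _ er]]] <-]; split; last exact: dd.
    move=> y; rewrite inE => /eqP ->; exists k.+1.
    by rewrite -linearZ exprS -scalerA -er -linearZ df //; apply: idealMl.
  have sfR : submod [set f r | r in setT].
    split; first by exists 0; rewrite ?linear0.
    by move=> a _ _ [u _ <-] [v _ <-]; exists (a *: u + v) => //; rewrite linearP.
  apply: (wreg_torsion_quotient (C := [set 0])) => //.
  + by move=> _ ->; exists 0; rewrite ?linear0.
  + move=> k e _; have [e' _ <-] := divisible_expr k divx (T0 _ e); by exists e'.
  + apply/(@wreg_iso _ _ _ f setT [set 0]) => //.
    * exact: (@submod_set0 R R^o).
    * by move=> _ [r _ <-]; exists r => //; rewrite subrr.
    * by move=> r _; split=> [/f_inj//|->]; rewrite /= linear0.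
  + move=> v /[dup] /C1Z [_ /exactS[g <-]] /C1E[k [r e]]; exists g => //; split=> //.
    exists k, (x ^+ k *: r) => //; rewrite linearZ; apply/esym/eqP.
    by rewrite -subr_eq0 -scalerBr e.
  + move=> g k _ [r _ er]; split.
      move=> /C1E[j [s es]]; apply/f_sub; exists s => //.
      have : x ^+ j *: f (r - x ^+ k *: s) = 0.
        by rewrite linearB linearZ er /= -scalerBr scalerA mulrC -scalerA es scaler0.
      rewrite -linearZ => /f_inj /xreg h.
      by rewrite scalerBr -er -linearZ -linearB h linear0.
    by move=> /f_sub[s _ es]; apply/C1E; exists k, s.
- by move=> n z.
Qed.

End Base.
End Complex.

(** * Divisibility in injective modules, and torsion *)

Section Quotient.
Variables (R : nzRingType) (V : lmodType R) (N : submodClosed V).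

Lemma quot_pi_scale a (v : V) : a *: quot_pi N v = quot_pi N (a *: v).
Proof. by rewrite quot_piZ. Qed.

Lemma quot_pi0 (v : V) : quot_pi N v = 0 <-> v \in N.
Proof.
have <- : quot_pi N 0 = 0 by apply: (addIr (quot_pi N 0)); rewrite -quot_piD !add0r.
by rewrite quot_pi_eq subr0.
Qed.

End Quotient.

Section Regular.
Variable R : comNzRingType.
Implicit Types (l q : seq R) (x y : R).

Lemma wreg_powers l p q n : @wreg R R^o setT (idl p) (l ++ q) ->
  @wreg R R^o setT (idl (p ++ [seq y ^+ n | y <- l])) q.
Proof.
elim: l p => [|x l IH] p; first by rewrite cats0.
move=> w; rewrite /= -cat_rcons; apply: IH; rewrite -idl_adjoin.
by apply: wreg_adjoin_expr w => //; exact: idl_ideal.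
Qed.

(** If all [y^n] kill [e], the map sending 1 to [e] on [R / (y^n : y in l)] extends along
    multiplication by [x], which is injective there; [e'] is the value of the extension at 1. *)
Lemma injective_divisible (E : lmodType R) (l : seq R) x : injective_module E ->
  (forall n r, idl [seq y ^+ n | y <- l] (x * r) -> idl [seq y ^+ n | y <- l] r) ->
  forall e : E, (forall y, y \in l -> exists k, y ^+ k *: e = 0) ->
  exists2 e', forall y, y \in l -> exists k, y ^+ k *: e' = 0 & x *: e' = e.
Proof.
move=> injE reg e te.
have [n tn] : exists n, forall y, y \in l -> y ^+ n *: e = 0.
  elim: l te {reg} => [|y l IH] te; first by exists 0%N.
  have [|n hn] := IH; first by move=> z zl; apply: te; rewrite inE zl orbT.
  have [k hk] := te y (mem_head _ _); exists (n + k)%N => z.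
  rewrite inE => /orP[/eqP ->|/hn h]; first by apply: expr_kill hk; apply: leq_addl.
  by apply: expr_kill h; apply: leq_addr.
set l' := [seq y ^+ n | y <- l] in reg.
pose N : submodClosed R^o := ideal_pred (IdealRec (idl_ideal l')).
have NE r : (r \in N) = `[< idl l' r >] by [].
have killN r : idl l' r -> r *: e = 0.
  move: r; apply: (@idl_sub _ _ [set r | r *: e = 0]).
    apply: ideal_intro => [|u v /= hu hv|a u /= hu]; first by rewrite /= scale0r.
      by rewrite scalerDl hu hv addr0.
    by rewrite -scalerA hu scaler0.
  by move=> _ /mapP[y yl ->]; apply: tn.
pose Q := quot_module N.
pose g (c : Q) : E := (repr c : R) *: e.
have gpi r : g (quot_pi N r) = r *: e.
  apply/eqP; rewrite -subr_eq0 -scalerBl; apply/eqP/killN/asboolP.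
  by rewrite -NE; apply/quot_pi_eq; rewrite quot_piK.
have glin : linear g.
  move=> a c c'; rewrite -(quot_piK c) -(quot_piK c') quot_pi_scale -quot_piD !gpi.
  by rewrite scalerDl scalerA.
pose G : {linear Q -> E} := HB.pack g (GRing.isLinear.Build R Q E _ g glin).
pose f : {linear Q -> Q} := x \*: idfun.
have f_inj : injective f.
  move=> c c' /eqP; rewrite -subr_eq0 -linearB -(quot_piK (c - c')) => /eqP.
  rewrite [f _]quot_pi_scale => /quot_pi0; rewrite NE => /asboolP/reg h.
  apply/eqP; rewrite -subr_eq0 -(quot_piK (c - c')); apply/eqP/quot_pi0.
  by rewrite NE; apply/asboolP.
have [h hE] := injE Q Q f G f_inj.
exists (h (quot_pi N 1)); last first.
  by rewrite -linearZ (hE (quot_pi N 1)) [LHS]gpi scale1r.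
move=> y yl; exists n; rewrite -linearZ [_ *: _]quot_pi_scale.
have -> : quot_pi N (y ^+ n *: (1 : R^o)) = 0.
  apply/quot_pi0; rewrite NE; apply/asboolP.
  by rewrite /GRing.scale /= mulr1; apply: mem_idl; apply: map_f.
exact: linear0.
Qed.

(** A long product of elements of [(x, l)] is a product from [(l)], which kills [e], plus a multiple
    of [x], which lowers the exponent [k]. *)
Lemma idl_prod_kill (V : lmodType R) l (e : V) :
  (forall y, y \in l -> exists k, y ^+ k *: e = 0) ->
  exists N, forall s, size s = N -> (forall a, a \in s -> idl l a) ->
    (\prod_(a <- s) a) *: e = 0.
Proof.
elim: l e => [|x l IHl] e te.
  exists 1%N => -[|a [|]] // _ /(_ a (mem_head _ _)) ->.
  by rewrite big_seq1 scale0r.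
have [k] := te x (mem_head _ _).
have tl y : y \in l -> exists k, y ^+ k *: e = 0 by move=> yl; apply: te; rewrite inE yl orbT.
elim: k e {te} tl => [|k IHk] e tl;
  first by rewrite scale1r => ->; exists 0%N => s _ _; rewrite scaler0.
rewrite exprSr -scalerA => /IHk[|N1 h1].
  move=> y /tl[j ej]; exists j; by rewrite scalerA mulrC -scalerA ej scaler0.
have [N2 h2] := IHl e tl.
exists (N2 + N1)%N => s ss sl.
have expand s0 : (forall a, a \in s0 -> idl (x :: l) a) -> exists s' w,
    [/\ size s' = size s0, forall a, a \in s' -> idl l a &
        \prod_(a <- s0) a = \prod_(a <- s') a + w * x].
  elim: s0 => [|a s0 IHs] h.
    by exists [::], 0; rewrite mul0r addr0.
  have [|s' [w [e1 e2 e3]]] := IHs; first by move=> b bs; apply: h; rewrite inE bs orbT.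
  have [z [u [_ hu ea]]] := h a (mem_head _ _).
  exists (u :: s'), (z * \prod_(b <- s0) b + u * w); split; rewrite /= ?e1 //.
    by move=> b; rewrite inE => /orP[/eqP -> //|/e2].
  rewrite !big_cons ea /GRing.scale /=.
  rewrite [in LHS]mulrDl {2}e3 mulrDr addrCA [in RHS]mulrDl -[x * z * _]mulrA.
  by rewrite [x * _]mulrC [u * (w * x)]mulrA.
have [|s' [w [e1 e2 e3]]] := expand (take N2 s).
  by move=> a /mem_take; apply: sl.
rewrite -(cat_take_drop N2 s) big_cat /= mulrC -scalerA e3 scalerDl h2 //; last first.
  by rewrite e1 size_takel // ss leq_addr.
rewrite add0r -!scalerA scalerA mulrC -scalerA h1 ?scaler0 //.
  by rewrite size_drop ss addKn.
by move=> a /mem_drop; apply: sl.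
Qed.

Lemma torsion_ptorsion (I : submodClosed R^o) (V : nat -> lmodType R) l n (e : V n) :
  [set` I] = idl l -> (e \in @torsion R I (V n)) <-> ptorsion l e.
Proof.
move=> eI; split=> [/asboolP[k hk] x xl|te].
  exists k; apply: hk; exists 1%N, (fun _ => 1), (fun _ => x ^+ k); split.
    move=> _; exists (fun _ => x); split; last by rewrite prodr_const card_ord.
    by move=> _; rewrite eI; apply: mem_idl.
  by rewrite big_ord1 mul1r.
have [N hN] := idl_prod_kill te; apply/asboolP; exists N => _ [k [c [s [hs ->]]]].
rewrite scaler_suml; apply: big1 => i _; rewrite -scalerA.
have [f [fI ->]] := hs i.
have -> : \prod_(j < N) f j = \prod_(a <- [seq f j | j <- enum 'I_N]) a.
  by rewrite big_map big_enum.
rewrite hN ?scaler0 //; first by rewrite size_map -cardE card_ord.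
move=> a /mapP[j _ ->].
by rewrite -eI; apply: fI.
Qed.

End Regular.

(** * Local cohomology of J *)

Section RegularLocal.
Variables (R : comNzRingType) (m : idealr R).
Hypotheses (nR : noetherian R) (lm : local_ring m).
Local Notation M := [set` m].

(** Every prefix ideal is prime by [rsop_prefix_prime], so an element outside it is regular modulo
    it; this covers the arbitrary last element [s] too. *)
Lemma rsop_wreg Q0 p l q s : is_prime Q0 ->
  prime_chain (size (p ++ l ++ q)) Q0 M -> idl (p ++ l ++ q) = M ->
  ~ idl (p ++ l) s -> @wreg R R^o setT (idl p) (rcons l s).
Proof.
move=> pQ0; elim: l p => [|x l IH] p c g ns.
  have [[_ _ pr] _] := rsop_prefix_prime nR lm pQ0 c g.
  by rewrite cats0 in ns; split=> // r _ /pr[].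
have [[_ _ pr] np] := rsop_prefix_prime nR lm pQ0 c g.
have npx : ~ idl p x by apply: (np x (l ++ q)).
split; first by move=> r _ /pr[].
rewrite idl_adjoin; apply: IH; rewrite ?cat_rcons //.
Qed.

Lemma rsop_adapted (I J : submodClosed R^o) : {subset J <= I} ->
  generated_by_part_of_rsop m I -> generated_by_part_of_rsop m J ->
  exists t w u, [/\ [set` J] = idl t, [set` I] = idl (t ++ w),
    idl ((t ++ w) ++ u) = M & krull_dim R (size ((t ++ w) ++ u))].
Proof.
have split_part s (t0 : seq R) : uniq s -> {subset t0 <= s} ->
    exists t u, [/\ t =i t0, t ++ u =i s & size (t ++ u) = size s].
  move=> us ts; exists (undup t0), [seq x <- s | x \notin t0].
  have e : undup t0 ++ [seq x <- s | x \notin t0] =i s.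
    move=> x; rewrite mem_cat mem_undup mem_filter.
    by case: (boolP (x \in t0)) => //= /ts ->.
  split=> //; first exact: mem_undup.
  apply: perm_size; apply: uniq_perm => //.
  rewrite cat_uniq undup_uniq filter_uniq // andbT /=.
  by apply/hasPn => x; rewrite mem_filter mem_undup => /andP[].
have idlE (l1 l2 : seq R) : l1 =i l2 -> idl l1 = idl l2.
  move=> e; apply/seteqP.
  by split; apply: idl_subl => x xl; apply: mem_idl; rewrite ?e // -e.
move=> JI [s [t0 [[us ks /generatesE gs] ts /generatesE gI]]].
move=> [s' [t0' [[us' ks' /generatesE gs'] ts' /generatesE gJ]]].
have [t [u [tE tuE stu]]] := split_part _ _ us ts.
have [t' [u' [tE' tuE' stu']]] := split_part _ _ us' ts'.
rewrite -(idlE _ _ tE) in gI; rewrite -(idlE _ _ tE') in gJ.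
rewrite -(idlE _ _ tuE) in gs; rewrite -(idlE _ _ tuE') in gs'.
rewrite -stu in ks; rewrite -stu' in ks'.
have eqd : size (t ++ u) = size (t' ++ u').
  by apply/eqP; rewrite eqn_leq ks'.2 ?ks.2 //; [case: ks'|case: ks].
have [Q0 pQ0 c] := krull_dim_chain nR lm ks'.
have [w ew sw] : exists2 w, idl (([::] ++ t') ++ w) = idl t & size (([::] ++ t') ++ w) = size t.
  apply: (rsop_exchange nR lm pQ0 (w := t) (u' := u')) => //.
    by rewrite gs; apply: idl_subl => x xt; apply: mem_idl; rewrite mem_cat xt.
  move=> x xt; rewrite -gI; apply: JI.
  by have : [set` J] x by rewrite gJ; apply: mem_idl.
rewrite cat0s in ew sw; exists t', w, u; split=> //; first by rewrite gI.
  rewrite gs; apply/seteqP; split; apply: idl_sub; try exact: idl_ideal.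
    move=> x; rewrite mem_cat => /orP[xt|xu].
      have : idl t x by rewrite -ew; apply: mem_idl.
      by apply: idl_subl => y yt; apply: mem_idl; rewrite mem_cat yt.
    by apply: mem_idl; rewrite mem_cat xu orbT.
  move=> x; rewrite mem_cat => /orP[xt|xu].
    have : idl (t' ++ w) x by rewrite ew; apply: mem_idl.
    by apply: idl_subl => y yt; apply: mem_idl; rewrite mem_cat yt.
  by apply: mem_idl; rewrite mem_cat xu orbT.
by rewrite size_cat sw -size_cat.
Qed.

End RegularLocal.

(** * From the torsion of a resolution to local cohomology *)

Section LocalCohomology.
Variables (R : comNzRingType) (J : submodClosed R^o).
Variable E : injective_resolution (submod_type J).
Local Notation d := (ires_diff E).

Lemma ires_dd n x : d n.+1 (d n x) = 0.
Proof. by apply/ires_exactS; exists x. Qed.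

Lemma ires_divisible p x q : @wreg R R^o setT [set 0] (p ++ x :: q) ->
  divisible (ires_obj E) p x.
Proof.
move=> w n e; apply: injective_divisible; first exact: ires_injective.
move=> k r; have [h _] := @wreg_powers R p [::] (x :: q) k w.
exact: h.
Qed.

Lemma filtered_all l rem q C :
  (forall p x q', l ++ rem ++ q = p ++ x :: q' -> divisible (ires_obj E) p x) ->
  filtered d l rem q C -> exists C', filtered d (l ++ rem) [::] q C'.
Proof.
elim: rem l C => [|x rem IH] l C div; first by rewrite cats0; exists C.
move=> /(filtered_step ires_dd) [|C' hC']; first exact: (div _ _ (rem ++ q)).
by rewrite -cat_rcons; apply: IH hC'; rewrite cat_rcons.
Qed.

Lemma wreg_cohomology_all l w q :
  (forall p x q', l ++ w ++ q = p ++ x :: q' -> divisible (ires_obj E) p x) ->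
  (forall n, wreg (pcocycle d l (n := n)) (pboundary d l (n := n)) (w ++ q)) ->
  forall n, wreg (pcocycle d (l ++ w) (n := n)) (pboundary d (l ++ w) (n := n)) q.
Proof.
elim: w l => [|x w IH] l div hw; first by rewrite cats0.
rewrite -cat_rcons; apply: IH; first by rewrite cat_rcons.
apply: (wreg_cohomology_step ires_dd) => //; exact: (div _ _ (w ++ q)).
Qed.

(** [filtered_base] treats [x], [filtered_step] the other generators of [J], and
    [wreg_cohomology_step] the generators [w] of [I] beyond [J]. *)
Lemma ires_wreg (x s : R) (rem w : seq R) :
  [set` J] = idl (x :: rem) -> is_prime (@idl R [::]) -> ~ idl [::] x ->
  @wreg R R^o setT [set 0] ((x :: rem ++ w) ++ [:: s]) ->
  @wreg R R^o setT (idl (x :: rem)) (w ++ [:: s]) ->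
  forall n, wreg (pcocycle d (x :: rem ++ w) (n := n))
                 (pboundary d (x :: rem ++ w) (n := n)) [:: s].
Proof.
move=> eJ p0 nx wR wJ.
have xreg k r : x ^+ k * r = 0 -> r = 0.
  by case: (p0) => _ _ h e; case: (h (x ^+ k) r) => // /(primeX p0 nx).
have JE r : r \in J <-> idl (x :: rem) r by rewrite -eJ.
have valJ (j : submod_type J) : idl (x :: rem) (val j) by apply/JE/(valP j).
pose iota : {linear submod_type J -> R^o} := val.
have [f fE] := @ires_injective _ _ E 0%N _ _ iota (ires_aug E) val_inj.
have augE r (rJ : idl (x :: rem) r) : exists2 j : submod_type J, val j = r & ires_aug E j = f r.
  have rJ' : r \in submod_pred J by apply/JE.
  by exists (@Submod _ _ J r rJ'); rewrite -?fE.
have Jx : idl (x :: rem) x by apply: mem_idl; apply: mem_head.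
(* [f] agrees with the injective augmentation only on [J], but [x r] lies in [J] and [x] is
   regular. *)
have f_inj r : f r = 0 -> r = 0.
  move=> fr; apply: (xreg 1%N); rewrite expr1.
  have [|j ej aj] := augE (x * r); first exact: idealMl (idl_ideal _) Jx.
  rewrite -ej (_ : j = 0) ?linear0 //; apply: (ires_aug_inj (i := E)).
  by rewrite aj linear0 -[x * r]/(x *: (r : R^o)) linearZ fr /= scaler0.
have div p y q' : x :: rem ++ (w ++ [:: s]) = p ++ y :: q' -> divisible (ires_obj E) p y.
  by move=> e; apply: (@ires_divisible p y q'); rewrite -e /= catA.
have [||||||C0 hC0] := @filtered_base R (ires_obj E) d ires_dd
    (idl (x :: rem)) x rem (w ++ [:: s]) f (idl_ideal _) _ xreg f_inj.
- by move=> y; apply: mem_idl.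
- move=> e; split=> [/ires_exact0[j <-]|[r /augE[j _ <-] <-]].
    by exists (val j) => //; rewrite -fE.
  by apply/ires_exact0; exists j.
- by move=> n e /ires_exactS.
- move=> n e; have [//|e' _ <-] := div [::] x (rem ++ (w ++ [:: s])) erefl n e.
  by exists e'.
- by rewrite /= catA.
- exact: wJ.
have [|C hC] := @filtered_all [:: x] rem (w ++ [:: s]) C0 _ hC0.
  exact: div.
apply: (@wreg_cohomology_all (x :: rem) w [:: s]); first exact: div.
by move=> n; apply: filtered_wreg hC.
Qed.

(** Reads annihilators of classes, which live in a quotient of nested subtypes, from elements of the
    resolution itself. *)
Lemma cohomology_class_eq0 (I : submodClosed R^o) l n :
  [set` I] = idl l ->
  forall c : local_cohomology I E n, exists2 e, pcocycle d l (n := n) e &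
    forall a, a *: c = 0 <-> pboundary d l (n := n) (a *: e).
Proof.
move=> eI c; pose z := repr c; exists (val (val z)).
  have te := torsion_ptorsion (V := ires_obj E) (val (val z)) eI.
  split; first exact/te/(valP (val z)).
  have /eqP h : val z \in @cocycle _ _ (fun n => Gamma_map I (ires_diff E n)) n := valP z.
  by have := congr1 val h.
move=> a; rewrite -{1}(quot_piK c) quot_pi_scale quot_pi0.
rewrite -[_ \in _]/(`[< _ >]); split.
  move=> /asboolP; rewrite -/z; case: n c z => [|n] c z /=.
    by move=> /(congr1 val) /= ->.
  move=> [y _ /(congr1 val) e]; exists (val y) => //.
  by apply/(torsion_ptorsion (V := ires_obj E) _ eI); apply: (valP y).
move=> h; apply/asboolP; move: h; rewrite -/z; case: n c z => [|n] c z /=.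
  by move=> h; apply: val_inj.
move=> [y /(torsion_ptorsion (V := ires_obj E) _ eI) ty e].
by exists (Submod ty) => //; apply: val_inj.
Qed.

End LocalCohomology.

Theorem proposition5p4 (R : comNzRingType) (m : idealr R) (p : nat)
    (I J : submodClosed R^o) :
  regular_local_ring m ->
  unramified_unequal_char m p ->
  {subset J <= I} ->
  generated_by_part_of_rsop m I ->
  generated_by_part_of_rsop m J ->
  p%:R \in J ->
  forall (E : injective_resolution (submod_type J)) (i : nat),
    finite_set (Ass (local_cohomology I E i)).
Proof.
move=> [nR lm _] [_ _ np2] JI gI gJ pJ E i.
have [t [w [u [eJ eI gM kd]]]] := rsop_adapted nR lm JI gI gJ.
have [Q0 pQ0 c] := krull_dim_chain nR lm kd.
(* An empty list would give [J = 0], so [p = 0] in [R], which lies in the square of [m]. *)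
case: t eJ eI gM kd c => [|x rem] eJ eI gM kd c.
  have p0 : p%:R = 0 :> R by have : [set` J] p%:R by []; rewrite eJ.
  case: np2; rewrite p0; exists 0%N, (fun _ => 0), (fun _ => 0).
  by rewrite big_ord0; split=> // -[].
have [p0 /(_ x _ erefl) nx] := rsop_prefix_prime nR lm (q := [::]) pQ0 c gM.
rewrite -catA in gM c.
apply: (sub_finite_set (B := [set [set` I]])); last exact: finite_set1.
move=> _ [P [xi hP] <-].
have [e he eE] := cohomology_class_eq0 eI xi.
have [_ nP1 prP] := prime_idealr_prime P.
apply/seteqP; split=> s /=.
  (* An [s] in [P] outside [I] kills the class and acts injectively, so the class is zero and [1]
     lies in [P]. *)
  move=> Ps; apply: contrapT => nIs; apply: nP1 => /=; apply/hP.
  have nidl : ~ idl ((x :: rem) ++ w) s by rewrite -eI.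
  have wR : @wreg R R^o setT (idl [::]) (((x :: rem) ++ w) ++ [:: s]).
    by rewrite cats1; apply: (@rsop_wreg R m nR lm Q0 [::] _ u s pQ0); rewrite // cat0s -catA.
  have wJ : @wreg R R^o setT (idl (x :: rem)) (w ++ [:: s]).
    by rewrite cats1; apply: (@rsop_wreg R m nR lm Q0 (x :: rem) w u s pQ0).
  have [reg _] := ires_wreg E eJ p0 nx wR wJ i.
  apply/eE; rewrite scale1r; apply: reg => //; apply/eE/hP.
  exact: Ps.
move=> Is; apply: contrapT => nPs.
have [te _] := he.
have /(torsion_ptorsion (V := ires_obj E) e eI)/asboolP[k hk] := te.
apply: (@primeX R [set` P] s k (prime_idealr_prime P) nPs) => /=.
apply/hP/eE; rewrite hk; first exact: submod0 (submod_pboundary _ _ _).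
exists 1%N, (fun _ => 1), (fun _ => s ^+ k); split; last by rewrite big_ord1 mul1r.
by move=> _; exists (fun _ => s); split=> //; rewrite prodr_const card_ord.
Qed.
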